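(* (i) A real number $\alpha>1$ has a purely periodic ECF expansion if and only if $\alpha$ is a quadratic surd with $-1<\bar\alpha<1$, where $\bar\alpha$ is the conjugate of $\alpha$. Furthermore, if $$\alpha=[\![\,\overline{(a_1,\epsilon_1);(a_2,\epsilon_2),\ldots,(a_r,\epsilon_r)}\,]\!]_e,$$ then $$\bar\alpha=-\langle\!\langle\,\overline{(a_r,\epsilon_r),\ldots,(a_1,\epsilon_1)}\,\rangle\!\rangle_e .$$ (ii) Two irrational numbers $\alpha,\beta>1$ are $\Theta$-equivalent if and only if there are $r,s\ge0$ such that $t_r(\alpha)=t_s(\beta)$, where $$t_m\big([\![(a_1,\epsilon_1);(a_2,\epsilon_2),\ldots]\!]_e\big):=(-\epsilon_1)\cdots(-\epsilon_m)\,[\![(a_{m+1},\epsilon_{m+1});(a_{m+2},\epsilon_{m+2}),\ldots]\!]_e .$$ (iii) The ECF expansion of an irrational $\alpha$ is eventually periodic if and only if $\alpha$ is a quadratic surd. (iv) A geodesic $\bar\gamma$ on $\mathcal M_e$ is closed if and only if it has a lift $\gamma\in\mathcal A_e$ with purely periodic endpoints $$\gamma_\infty=\epsilon\,[\![\,\overline{(a_1,\epsilon_1);(a_2,\epsilon_2),\ldots,(a_r,\epsilon_r)}\,]\!]_e\quad\text{and}\quad \gamma_{-\infty}=-\epsilon\,\langle\!\langle\,\overline{(a_r,\epsilon_r),\ldots,(a_2,\epsilon_2),(a_1,\epsilon_1)}\,\rangle\!\rangle_e$$ for some $\epsilon\in\{\pm1\}$ and $(-\epsilon_1)\cdots(-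\epsilon_r)=1$.
   Context: $\Theta$ is the index three subgroup of $\operatorname{PSL}(2,\mathbb Z)$ consisting of the matrices congruent modulo $2$ to $\left(\begin{smallmatrix}1&0\\0&1\end{smallmatrix}\right)$ or $\left(\begin{smallmatrix}0&1\\1&0\end{smallmatrix}\right)$; it is generated by $z\mapsto-1/z$ and $z\mapsto z+2$. Two real numbers are $\Theta$-equivalent if they lie in the same orbit of $\Theta$ acting by Möbius transformations. $\mathbb H$ is the upper half-plane and $\mathcal M_e=\Theta\backslash\mathbb H$. Geodesics are oriented; for a geodesic $\gamma$ in $\mathbb H$, $\gamma_{-\infty}$ and $\gamma_\infty$ are its negative (backward) and positive (forward) endpoints. $\mathcal A_e$ is the set of geodesics $\gamma$ in $\mathbb H$ with $$(\gamma_\infty,\gamma_{-\infty})\in\mathcal S_e:=\big((-\infty,-1)\cup(1,\infty)\big)\times(-1,1).$$ Even continued fractions (ECF): every irrational $x\in[0,1]$ has a unique infinite expansion $$x=[\![(a_1,\epsilon_1),(a_2,\epsilon_2),\ldots]\!]_e=\cfrac{1}{a_1+\cfrac{\epsilon_1}{a_2+\cfrac{\epsilon_2}{a_3+\cdots}}},\qquad \epsilon_i\in\{\pm1\},\ a_i \text{ even positive integers.}$$ Every irrational $x>1$ has a unique infinite ECF expansion $$x=[\![(a_1,\epsilon_1);(a_2,\epsilon_2),\ldots]\!]_e:=a_1+\epsilon_1[\![(a_2,\epsilon_2),(a_3,\epsilon_3),\ldots]\!]_e$$ with digits of the same kind. So ECF expansions are defined for positive irrationals. Extended even continued fractions: for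 $\epsilon_i\in\{\pm1\}$ and even positive integers $b_i$, $$\langle\!\langle(b_0,\epsilon_0),(b_1,\epsilon_1),\ldots\rangle\!\rangle_e:=\cfrac{\epsilon_0}{b_0+\cfrac{\epsilon_1}{b_1+\cdots}}\in(-1,1).$$ An overline means that the block of digits is repeated periodically forever. A quadratic surd is a real irrational root of a quadratic polynomial with integer coefficients; its conjugate is the other root. *)

(* Defs.v *)
From Stdlib Require Import Reals ZArith List ClassicalEpsilon.
From Coquelicot Require Import Coquelicot.
Import ListNotations.
Open Scope R_scope.

Definition irrational (x : R) : Prop :=
  ~ exists p q : Z, q <> 0%Z /\ x = IZR p / IZR q.

Definition is_root (A B C : Z) (x : R) : Prop :=
  IZR A * x ^ 2 + IZR B * x + IZR C = 0.

Definition quadratic_surd (x : R) : Prop :=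
  irrational x /\ exists A B C : Z, A <> 0%Z /\ is_root A B C x.

Definition is_conjugate (x y : R) : Prop :=
  exists A B C : Z, A <> 0%Z /\ is_root A B C x /\ is_root A B C y /\ y <> x.

(* For a quadratic surd x the other root exists and does not depend on the
   polynomial. *)
Definition surd_conj (x : R) : R := epsilon (inhabits 0) (is_conjugate x).

(** * Even continued fractions *)

(* (a, e) with a even positive and e = 1 or -1.  A digit sequence d is indexed
   from 0, so d 0 is the first digit of the expansion. *)
Definition digit : Type := (Z * Z)%type.

Definition admissible (d : digit) : Prop :=
  (0 < fst d)%Z /\ Z.Even (fst d) /\ (snd d = 1%Z \/ snd d = (-1)%Z).

Definition skip (m : nat) (d : nat -> digit) : nat -> digit :=
  fun n => d (m + n)%nat.

(* 1 / (a_1 + e_1 / (a_2 + ... + e_{n-1} / a_n)) *)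
Fixpoint ecf_convergent (n : nat) (d : nat -> digit) : R :=
  match n with
  | O => 0
  | S n' =>
      1 / (IZR (fst (d 0%nat)) + IZR (snd (d 0%nat)) * ecf_convergent n' (skip 1 d))
  end.

(* [[(a_1,e_1),(a_2,e_2),...]]_e.  The convergents converge for every sequence
   of admissible digits, so that Lim_seq is a genuine limit there; likewise for
   ext_ecf. *)
Definition ecf_frac (d : nat -> digit) : R :=
  real (Lim_seq (fun n => ecf_convergent n d)).

(* [[(a_1,e_1);(a_2,e_2),...]]_e *)
Definition ecf_int (d : nat -> digit) : R :=
  IZR (fst (d 0%nat)) + IZR (snd (d 0%nat)) * ecf_frac (skip 1 d).

(* e_0 / (b_0 + e_1 / (b_1 + ... + e_{n-1} / b_{n-1})) *)
Fixpoint ext_convergent (n : nat) (d : nat -> digit) : R :=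
  match n with
  | O => 0
  | S n' =>
      IZR (snd (d 0%nat)) / (IZR (fst (d 0%nat)) + ext_convergent n' (skip 1 d))
  end.

(* <<(b_0,e_0),(b_1,e_1),...>>_e *)
Definition ext_ecf (d : nat -> digit) : R :=
  real (Lim_seq (fun n => ext_convergent n d)).

Definition ecf_expansion (d : nat -> digit) (x : R) : Prop :=
  (forall n, admissible (d n)) /\
  ((0 <= x <= 1 /\ x = ecf_frac d) \/ (1 < x /\ x = ecf_int d)).

(* Every positive irrational has exactly one infinite expansion, and this is
   it. *)
Definition ecf_digits (x : R) : nat -> digit :=
  epsilon (inhabits (fun _ => (2, 1)%Z)) (fun d => ecf_expansion d x).

Definition is_block (l : list digit) : Prop := l <> [] /\ List.Forall admissible l.

(* The block l repeated forever; the default value of nth is never reached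
   when l is nonempty. *)
Definition cycle (l : list digit) : nat -> digit :=
  fun n => nth (n mod length l)%nat l (2, 1)%Z.

Definition has_purely_periodic_ecf (x : R) : Prop :=
  exists l, is_block l /\ ecf_expansion (cycle l) x.

Definition eventually_periodic (d : nat -> digit) : Prop :=
  exists N l, is_block l /\ forall n, d (N + n)%nat = cycle l n.

(* (-e_1) ... (-e_r) *)
Definition sign_prod (l : list digit) : Z :=
  fold_right (fun d s => (- snd d * s)%Z) 1%Z l.

(* t_m, for irrational x > 1 *)
Definition ecf_tail (m : nat) (x : R) : R :=
  IZR (sign_prod (map (ecf_digits x) (seq 0 m))) * ecf_int (skip m (ecf_digits x)).

(** * The theta group *)

Record SL2Z : Type := mkSL2Z {
  ma : Z; mb : Z; mc : Z; md : Z;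
  mdet : (ma * md - mb * mc = 1)%Z }.

(* The subgroup of SL(2,Z) whose image in PSL(2,Z) is Theta.  It contains -1,
   and M and -M act by the same Moebius transformation. *)
Definition Theta (M : SL2Z) : Prop :=
  ((ma M mod 2, mb M mod 2, mc M mod 2, md M mod 2) = (1, 0, 0, 1) \/
   (ma M mod 2, mb M mod 2, mc M mod 2, md M mod 2) = (0, 1, 1, 0))%Z.

Definition Theta_equiv (x y : R) : Prop :=
  exists M, Theta M /\
    IZR (mc M) * x + IZR (md M) <> 0 /\
    y = (IZR (ma M) * x + IZR (mb M)) / (IZR (mc M) * x + IZR (md M)).

Definition moebius (M : SL2Z) (z : C) : C :=
  ((RtoC (IZR (ma M)) * z + RtoC (IZR (mb M))) /
   (RtoC (IZR (mc M)) * z + RtoC (IZR (md M))))%C.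

(** * Geodesics in the upper half-plane H and on Theta\H *)

Definition hyp_dist (z w : C) : R :=
  2 * arcsinh (Cmod (z - w)%C / (2 * sqrt (Im z * Im w))).

(* Unit-speed parametrized complete geodesic lines; the orientation is that of
   the parameter. *)
Definition geodesic (g : R -> C) : Prop :=
  (forall t, 0 < Im (g t)) /\
  (forall s t, hyp_dist (g s) (g t) = Rabs (s - t)).

(* The real number x is the forward, resp. backward, endpoint of g.  A geodesic
   with endpoint at infinity has no such x. *)
Definition forward_endpoint (g : R -> C) (x : R) : Prop :=
  filterlim g (Rbar_locally p_infty) (locally (RtoC x)).

Definition backward_endpoint (g : R -> C) (x : R) : Prop :=
  filterlim g (Rbar_locally m_infty) (locally (RtoC x)).

Definition S_e (x y : R) : Prop := (x < -1 \/ 1 < x) /\ -1 < y < 1.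

Definition A_e (g : R -> C) : Prop :=
  geodesic g /\
  exists x y, forward_endpoint g x /\ backward_endpoint g y /\ S_e x y.

(* Points of M_e = Theta\H are the orbits, as subsets of H. *)
Definition orbit (z : C) : C -> Prop :=
  fun w => exists M, Theta M /\ w = moebius M z.

Definition is_lift (g : R -> C) (gbar : R -> C -> Prop) : Prop :=
  geodesic g /\ forall t, gbar t = orbit (g t).

Definition geodesic_on_Me (gbar : R -> C -> Prop) : Prop :=
  exists g, is_lift g gbar.

Definition closed_geodesic_on_Me (gbar : R -> C -> Prop) : Prop :=
  exists T, 0 < T /\ forall t, gbar (t + T) = gbar t.

(* Main.v *)
From Stdlib Require Import Reals ZArith List Lra Lia.
From Stdlib Require Import ClassicalEpsilon FunctionalExtensionality PropExtensionality.
From Stdlib Require Import FinFun Cantor.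
From Coquelicot Require Import Coquelicot.
Require Import Defs.
Import ListNotations.
Open Scope R_scope.

(** Everything is read off the dynamics of the step [z |-> e / (z - a)] that
    removes the first digit [(a, e)] of a continued fraction, applied both to a
    number and to its conjugate.

    Convergence.  The inverse step [y |-> e / (b + y)] maps [[-1, 1]] into
    itself.  A composite of [n] of them maps it onto an interval between two
    fractions [p/q] and [r/s] with [|p s - r q| = 2] and [q + s >= n + 2], hence
    of length at most [2 / (n + 1)] ([branches_interval],
    [branches_contraction]).  So all expansions converge, and an orbit of the
    steps that stays outside [(-1, 1)] forever starts at the value of the
    expansion ([ecf_int_unique]).

    Periods.  Call [x > 1] with conjugate [y] reduced when [-1 < y < 1]; this is
    preserved by the steps ([reduced_step]).  A reduced pair with integral
    equation [A z^2 + B z + C = 0] of discriminant [D] has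
    [(B - A - C) (B + A + C) > 0], which together with [(A - C)^2] adds up to
    [D]; so there are finitely many of them ([reduced_bounded]), and since the
    step is injective on reduced pairs ([reduced_back]) the expansion is purely
    periodic ([reduced_purely_periodic]).  Conversely a period gives an integral
    matrix fixing both [x] and minus the value of the reversed period, which lies
    in [[-1, 1]] and hence is the conjugate ([periodic_conjugate]).  An arbitrary
    surd becomes reduced after finitely many steps: otherwise the orbits of [x]
    and of [y] would both stay outside [(-1, 1)], and [x] and [y] would have the
    same expansion ([digit_orbit_eventually_reduced]).

    Theta-equivalence.  With the signs [(-e_1) ... (-e_m)] in front, the steps
    become [z |-> -1 / (z - a)] with [a] even, which lie in Theta
    ([orbit_matrix]), and the tails [t_m] are the iterates of one map
    [theta_map] defined on all irrationals ([ecf_tail_iter]).  Having a common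
    iterate under it is visibly invariant under [z + 2] and [-1/z], and a descent
    on the lower left entry reduces every element of Theta to these
    ([theta_tail_equiv]).

    Closed geodesics.  In the coordinates [(1, x, x^2 + y^2) / y] of a point
    [x + i y], which identify the half-plane with a hyperboloid in
    three-dimensional Minkowski space, Moebius maps are linear and the
    unit-speed geodesics take the form [A exp t + B exp (-t)] with null vectors
    [A], [B] that represent the two endpoints ([geodesic_line]).  If the image
    of the geodesic closes up after time [T], then at every time [t] some
    element of Theta moves [g t] to [g (t + T)]; Theta being countable and [R]
    not, one element [M] serves for two different times, and then linear
    algebra makes [A] and [B] eigenvectors of [M] with eigenvalues [exp T] and
    [exp (-T)] ([closed_translation]).  So the endpoints are conjugate surds,
    and the steps above move them to a purely periodic pair
    ([conjugate_pair_reduces]).  Conversely the matrix of a period of positive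
    sign translates the geodesic along itself ([translation_closes]). *)

(** * Contraction by inverse branches *)

Definition prefix (n : nat) (d : nat -> digit) : list digit := map d (seq 0 n).

Lemma prefix_S n d : prefix (S n) d = d 0%nat :: prefix n (skip 1 d).
Proof.
  unfold prefix. simpl. rewrite <- seq_shift, map_map. reflexivity.
Qed.

Lemma prefix_S_last n d : prefix (S n) d = prefix n d ++ [d n].
Proof. unfold prefix. rewrite seq_S, map_app. reflexivity. Qed.

Lemma prefix_length n d : length (prefix n d) = n.
Proof. unfold prefix. rewrite length_map, length_seq. reflexivity. Qed.

Lemma prefix_admissible n d :
  (forall k, admissible (d k)) -> List.Forall admissible (prefix n d).
Proof.
  intros H. apply Forall_forall. intros x Hx.
  apply in_map_iff in Hx. destruct Hx as [k [<- _]]. apply H.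
Qed.

Lemma skip_skip m n d : skip m (skip n d) = skip (n + m) d.
Proof.
  apply functional_extensionality; intros k. unfold skip. f_equal. lia.
Qed.

Lemma admissible_fst_ge_2 d : admissible d -> (2 <= fst d)%Z.
Proof. intros [H [[k Hk] _]]. lia. Qed.

Lemma admissible_IZR d : admissible d ->
  2 <= IZR (fst d) /\ (IZR (snd d) = 1 \/ IZR (snd d) = -1).
Proof.
  intros H. split.
  - apply IZR_le. apply admissible_fst_ge_2, H.
  - destruct H as [_ [_ [-> | ->]]]; auto.
Qed.

Definition branch (d : digit) (y : R) : R := IZR (snd d) / (IZR (fst d) + y).

Definition branches (l : list digit) (y : R) : R := fold_right branch y l.

Lemma branch_bounded d y : admissible d -> -1 <= y <= 1 -> -1 <= branch d y <= 1.
Proof.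
  intros H Hy. destruct (admissible_IZR _ H) as [Ha He].
  unfold branch. apply Rabs_le_between.
  assert (0 < IZR (fst d) + y) by lra.
  rewrite Rabs_div by lra. rewrite (Rabs_pos_eq (_ + _)) by lra.
  apply Rle_div_l; [lra|].
  destruct He as [-> | ->]; unfold Rabs; destruct Rcase_abs; lra.
Qed.

Lemma branches_bounded l y :
  List.Forall admissible l -> -1 <= y <= 1 -> -1 <= branches l y <= 1.
Proof.
  intros H Hy. induction H; simpl; [exact Hy|].
  apply branch_bounded; assumption.
Qed.

(** Invariant: the image of [[-1, 1]] lies between two fractions with
    determinant 2.  A further
    branch sends [p/q] to [e q / (b q + p)]: the determinant is preserved up to
    sign, no denominator decreases, and one stays the same only if [p/q] is
    [-1], which cannot happen at both ends, so their sum grows by at least one.  The last clause says without division that the value lies between the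
    two fractions, in either order. *)
Lemma branches_interval l : List.Forall admissible l ->
  exists p q r s : Z,
    (Z.abs p <= q /\ Z.abs r <= s /\ 1 <= q /\ 1 <= s)%Z /\
    (Z.of_nat (length l) + 2 <= q + s)%Z /\
    (Z.abs (p * s - r * q) = 2)%Z /\
    forall y, -1 <= y <= 1 ->
      (IZR q * branches l y - IZR p) * (IZR s * branches l y - IZR r) <= 0.
Proof.
  induction 1 as [|d l Hd Hl IH].
  - exists (-1)%Z, 1%Z, 1%Z, 1%Z. simpl. repeat split; try lia. intros y Hy. nra.
  - destruct IH as (p & q & r & s & Hb & Hn & Hdet & Hy).
    pose proof (admissible_fst_ge_2 _ Hd) as Ha.
    exists (snd d * q)%Z, (fst d * q + p)%Z, (snd d * s)%Z, (fst d * s + r)%Z.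
    assert (He : snd d = 1%Z \/ snd d = (-1)%Z) by apply Hd.
    assert (Hq : (q + (q + p) <= fst d * q + p)%Z) by nia.
    assert (Hs : (s + (s + r) <= fst d * s + r)%Z) by nia.
    split; [|split; [|split]].
    + destruct He as [-> | ->]; lia.
    + assert (~ ((q + p) = 0 /\ (s + r) = 0)%Z).
      { intros [E1 E2]. assert (p = - q)%Z by lia. assert (r = -s)%Z by lia. subst.
        replace (- q * s - - s * q)%Z with 0%Z in Hdet by ring. simpl in Hdet. lia. }
      cbn [length]. lia.
    + destruct He as [-> | ->];
      match goal with |- Z.abs ?t = _ =>
        assert (t = (p * s - r * q)%Z \/ t = (- (p * s - r * q))%Z) as [-> | ->]
        by ((left; ring) || (right; ring)) end; lia.
    + intros y Hy1. specialize (Hy y Hy1).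
      pose proof (branches_bounded l y Hl Hy1) as Hg.
      cbn [branches fold_right]. fold (branches l y). unfold branch.
      set (g := branches l y) in *.
      destruct (admissible_IZR _ Hd) as [HaR HeR].
      rewrite !plus_IZR, !mult_IZR.
      set (a := IZR (fst d)) in *. set (e := IZR (snd d)) in *.
      assert (Hag : 0 < a + g) by lra.
      replace (((a * IZR q + IZR p) * (e / (a + g)) - e * IZR q) *
               ((a * IZR s + IZR r) * (e / (a + g)) - e * IZR s))
        with ((e * e) * ((IZR q * g - IZR p) * (IZR s * g - IZR r)) * (/ (a + g)) ^ 2)
        by (field; lra).
      assert (e * e = 1) as -> by (destruct HeR as [-> | ->]; lra).
      assert (0 < (/ (a + g)) ^ 2) by (apply pow_lt, Rinv_0_lt_compat, Hag).
      nra.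
Qed.

(** Two points between [p/q] and [r/s] differ by at most [2 / (q s)], and
    [q s >= q + s - 1]. *)
Lemma branches_contraction l y1 y2 : List.Forall admissible l ->
  -1 <= y1 <= 1 -> -1 <= y2 <= 1 ->
  Rabs (branches l y1 - branches l y2) <= 2 / (INR (length l) + 1).
Proof.
  intros Hl H1 H2.
  destruct (branches_interval l Hl) as (p & q & r & s & Hb & Hn & Hdet & Hy).
  specialize (Hy y1 H1) as G1. specialize (Hy y2 H2) as G2.
  set (g1 := branches l y1) in *. set (g2 := branches l y2) in *. clearbody g1 g2.
  assert (Hq : 1 <= IZR q) by (apply IZR_le; lia).
  assert (Hs : 1 <= IZR s) by (apply IZR_le; lia).
  assert (Hqs : INR (length l) + 1 <= IZR q * IZR s).
  { rewrite INR_IZR_INZ, <- mult_IZR, <- plus_IZR. apply IZR_le. nia. }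
  assert (Hd : IZR p * IZR s - IZR r * IZR q = 2 \/ IZR p * IZR s - IZR r * IZR q = -2).
  { rewrite <- !mult_IZR, <- minus_IZR.
    assert (p * s - r * q = 2 \/ p * s - r * q = -2)%Z as [-> | ->] by lia; auto. }
  assert (Hpos : 0 <= INR (length l)) by apply pos_INR.
  apply Rle_trans with (2 / (IZR q * IZR s)).
  2:{ apply Rmult_le_compat_l; [lra|]. apply Rinv_le_contravar; lra. }
  assert (HQ : 0 < IZR q * IZR s) by lra.
  apply Rle_div_r; [exact HQ|].
  rewrite <- (Rabs_pos_eq (IZR q * IZR s)) by lra. rewrite <- Rabs_mult.
  apply Rabs_le_between.
  set (Q := IZR q) in *. set (S := IZR s) in *. set (P := IZR p) in *. set (T := IZR r) in *.
  clearbody Q S P T.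
  (* after scaling by [Q * S], the ends of the interval are 2 apart *)
  assert (K : forall g, (Q * g - P) * (S * g - T) <= 0 ->
     (Q * S * g - P * S) * (Q * S * g - T * Q) <= 0).
  { intros g Hg. replace ((Q * S * g - P * S) * (Q * S * g - T * Q)) with
      (S * Q * ((Q * g - P) * (S * g - T))) by ring. nra. }
  apply K in G1. apply K in G2.
  replace ((g1 - g2) * (Q * S)) with (Q * S * g1 - Q * S * g2) by ring.
  set (u1 := Q * S * g1) in *. set (u2 := Q * S * g2) in *.
  set (m := P * S) in *. set (n := T * Q) in *. clearbody u1 u2 m n.
  destruct Hd.
  - assert (n = m - 2) by lra. subst n.
    assert (m - 2 <= u1 <= m) by (split; nra).
    assert (m - 2 <= u2 <= m) by (split; nra). lra.
  - assert (n = m + 2) by lra. subst n.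
    assert (m <= u1 <= m + 2) by (split; nra).
    assert (m <= u2 <= m + 2) by (split; nra). lra.
Qed.

Lemma prefix_contraction n d y1 y2 : (forall k, admissible (d k)) ->
  -1 <= y1 <= 1 -> -1 <= y2 <= 1 ->
  Rabs (branches (prefix n d) y1 - branches (prefix n d) y2) <= 2 / (INR n + 1).
Proof.
  intros Hd H1 H2.
  pose proof (branches_contraction (prefix n d) y1 y2 (prefix_admissible n d Hd) H1 H2) as H.
  rewrite prefix_length in H. exact H.
Qed.

Lemma ext_convergent_branches n d : ext_convergent n d = branches (prefix n d) 0.
Proof.
  revert d. induction n; intros d; [reflexivity|].
  rewrite prefix_S. simpl. rewrite IHn. reflexivity.
Qed.

Lemma branches_app l l' y : branches (l ++ l') y = branches l (branches l' y).
Proof. apply fold_right_app. Qed.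

Lemma prefix_plus m n d : prefix (m + n) d = prefix m d ++ prefix n (skip m d).
Proof.
  unfold prefix. rewrite seq_app, map_app. f_equal. simpl.
  rewrite <- (Nat.add_0_r m) at 1. generalize 0%nat as k. induction n; intros k; [reflexivity|].
  simpl. f_equal. rewrite <- IHn. rewrite Nat.add_succ_r. reflexivity.
Qed.

Lemma ext_convergents_close n m d : (forall n, admissible (d n)) -> (n <= m)%nat ->
  Rabs (ext_convergent m d - ext_convergent n d) <= 2 / (INR n + 1).
Proof.
  intros Hd Hm. rewrite !ext_convergent_branches.
  replace m with (n + (m - n))%nat by lia. rewrite prefix_plus, branches_app.
  apply prefix_contraction; [exact Hd | | lra].
  apply branches_bounded; [apply prefix_admissible; intros; apply Hd | lra].
Qed.

Lemma inv_eventually_small (eps : posreal) :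
  exists N, forall n, (N <= n)%nat -> 2 / (INR n + 1) < eps.
Proof.
  destruct (nfloor_ex (2 / eps)) as [N HN].
  { apply Rlt_le, Rdiv_lt_0_compat; [lra | apply cond_pos]. }
  exists N. intros n Hn.
  pose proof (le_INR _ _ Hn). pose proof (pos_INR N). pose proof (cond_pos eps).
  apply Rlt_div_l; [lra|].
  destruct HN as [_ HN]. apply Rlt_div_l in HN; [|assumption]. nra.
Qed.

Lemma ext_convergents_converge d : (forall n, admissible (d n)) ->
  is_lim_seq (fun n => ext_convergent n d) (ext_ecf d).
Proof.
  intros Hd. apply Lim_seq_correct'.
  apply ex_lim_seq_cauchy_corr. intros eps.
  destruct (inv_eventually_small eps) as [N HN].
  exists N. intros n m Hn Hm.
  destruct (Nat.le_ge_cases n m) as [H|H].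
  - rewrite Rabs_minus_sym. eapply Rle_lt_trans; [apply ext_convergents_close; assumption|].
    apply HN, Hn.
  - eapply Rle_lt_trans; [apply ext_convergents_close; assumption|]. apply HN, Hm.
Qed.

(** The value is the only bounded backward solution of the branch recursion;
    this is how all later identities between expansions are obtained. *)
Lemma ext_ecf_unique d (y : nat -> R) :
  (forall n, admissible (d n)) -> (forall n, -1 <= y n <= 1) ->
  (forall n, y n = branch (d n) (y (S n))) ->
  y 0%nat = ext_ecf d.
Proof.
  intros Hd Hb Hy.
  assert (E : forall n, y 0%nat = branches (prefix n d) (y n)).
  { induction n; [reflexivity|].
    rewrite prefix_S_last, branches_app. simpl. rewrite <- Hy. exact IHn. }
  assert (L : is_lim_seq (fun n => ext_convergent n d) (y 0%nat)).
  { apply is_lim_seq_spec. intros eps. destruct (inv_eventually_small eps) as [N HN].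
    exists N. intros n Hn. eapply Rle_lt_trans; [|apply (HN n Hn)].
    rewrite ext_convergent_branches, (E n).
      apply prefix_contraction; [exact Hd | lra | apply Hb]. }
  unfold ext_ecf. rewrite (is_lim_seq_unique _ _ L). reflexivity.
Qed.

Lemma ext_ecf_bounded d : (forall n, admissible (d n)) -> -1 <= ext_ecf d <= 1.
Proof.
  intros Hd. pose proof (ext_convergents_converge d Hd) as L.
  assert (B : forall n, -1 <= ext_convergent n d <= 1).
  { intros n. rewrite ext_convergent_branches.
    apply branches_bounded; [apply prefix_admissible, Hd | lra]. }
  split.
  - apply (is_lim_seq_le (fun _ => -1) (fun n => ext_convergent n d) (-1) (ext_ecf d)).
    + intros n. apply B.
    + apply is_lim_seq_const.
    + exact L.
  - apply (is_lim_seq_le (fun n => ext_convergent n d) (fun _ => 1) (ext_ecf d) 1).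
    + intros n. apply B.
    + exact L.
    + apply is_lim_seq_const.
Qed.

Lemma skip_admissible m d :
  (forall n, admissible (d n)) -> forall n, admissible (skip m d n).
Proof. intros H n. apply H. Qed.

Lemma ext_ecf_branch d : (forall n, admissible (d n)) ->
  ext_ecf d = branch (d 0%nat) (ext_ecf (skip 1 d)).
Proof.
  intros Hd.
  pose proof (ext_convergents_converge d Hd) as L.
  pose proof (ext_convergents_converge _ (skip_admissible 1 d Hd)) as L'.
  pose proof (ext_ecf_bounded _ (skip_admissible 1 d Hd)) as B.
  destruct (admissible_IZR _ (Hd 0%nat)) as [Ha _].
  apply is_lim_seq_incr_1 in L.
  assert (L2 : is_lim_seq (fun n => ext_convergent (S n) d)
                 (branch (d 0%nat) (ext_ecf (skip 1 d)))).
  { simpl. unfold branch. apply is_lim_seq_div'.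
    - apply is_lim_seq_const.
    - apply is_lim_seq_plus'; [apply is_lim_seq_const | exact L'].
    - lra. }
  apply is_lim_seq_unique in L. apply is_lim_seq_unique in L2. rewrite L in L2.
  injection L2. trivial.
Qed.

(** An ordinary fraction [1 / (a_1 + e_1 / (a_2 + ...))] carries the sign of a
    level in front of the next one, an extended fraction in front of its own
    level.  Delaying the signs by one place turns the first kind, multiplied by
    [e], into the second, so that only one limit theory is needed. *)
Definition lag (e : Z) (d : nat -> digit) : nat -> digit := fun n =>
  match n with
  | O => (fst (d 0%nat), e)
  | S k => (fst (d (S k)), snd (d k))
  end.

Lemma skip_1_lag e d : skip 1 (lag e d) = lag (snd (d 0%nat)) (skip 1 d).
Proof. apply functional_extensionality. intros [|n]; reflexivity. Qed.

Lemma lag_admissible e d : e = 1%Z \/ e = (-1)%Z ->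
  (forall n, admissible (d n)) -> forall n, admissible (lag e d n).
Proof.
  intros He H [|n]; split; try apply H; split; simpl; try apply H; exact He.
Qed.

Lemma ecf_convergent_lag n e d :
  IZR e * ecf_convergent n d = ext_convergent n (lag e d).
Proof.
  revert e d. induction n; intros e d; cbn [ecf_convergent ext_convergent]; [ring|].
  rewrite skip_1_lag, <- IHn. unfold Rdiv. simpl. ring.
Qed.

Lemma ecf_frac_lag e d : e = 1%Z \/ e = (-1)%Z -> (forall n, admissible (d n)) ->
  IZR e * ecf_frac d = ext_ecf (lag e d).
Proof.
  intros He Hd.
  assert (L1 : is_lim_seq (fun n => ecf_convergent n d) (ext_ecf (lag 1 d))).
  { apply (is_lim_seq_ext (fun n => ext_convergent n (lag 1 d)));
      [|apply ext_convergents_converge, lag_admissible; auto].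
    intros n. rewrite <- (ecf_convergent_lag n 1 d). simpl. ring. }
  assert (E : ecf_frac d = ext_ecf (lag 1 d)).
  { unfold ecf_frac. rewrite (is_lim_seq_unique _ _ L1). reflexivity. }
  rewrite <- E in L1.
  pose proof (ext_convergents_converge _ (lag_admissible e d He Hd)) as L2.
  assert (L3 : is_lim_seq (fun n => ext_convergent n (lag e d)) (IZR e * ecf_frac d)).
  { apply (is_lim_seq_ext (fun n => IZR e * ecf_convergent n d)).
    - intros n. apply ecf_convergent_lag.
    - apply is_lim_seq_mult'; [apply is_lim_seq_const | exact L1]. }
  apply is_lim_seq_unique in L2. apply is_lim_seq_unique in L3. rewrite L2 in L3.
  injection L3. auto.
Qed.

Lemma ecf_int_lag d : (forall n, admissible (d n)) ->
  ecf_int d = IZR (fst (d 0%nat)) + ext_ecf (skip 1 (lag 1 d)).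
Proof.
  intros Hd. unfold ecf_int. rewrite ecf_frac_lag, skip_1_lag; auto.
  - apply Hd.
  - apply skip_admissible, Hd.
Qed.

Lemma ecf_int_ge_1 d : (forall n, admissible (d n)) -> 1 <= ecf_int d.
Proof.
  intros Hd. rewrite ecf_int_lag by exact Hd.
  pose proof (ext_ecf_bounded _ (skip_admissible 1 _ (lag_admissible 1 d (or_introl eq_refl) Hd))).
  destruct (admissible_IZR _ (Hd 0%nat)). lra.
Qed.

Lemma ecf_frac_inv d : (forall n, admissible (d n)) -> ecf_frac d = / ecf_int d.
Proof.
  intros Hd. rewrite ecf_int_lag by exact Hd.
  rewrite <- (Rmult_1_l (ecf_frac d)), (ecf_frac_lag 1) by auto.
  rewrite ext_ecf_branch by (apply lag_admissible; auto).
  unfold branch, Rdiv. simpl. ring.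
Qed.

Lemma ecf_int_step d : (forall n, admissible (d n)) ->
  ecf_int d = IZR (fst (d 0%nat)) + IZR (snd (d 0%nat)) / ecf_int (skip 1 d).
Proof.
  intros Hd. unfold ecf_int at 1. rewrite ecf_frac_inv by (apply skip_admissible, Hd).
  reflexivity.
Qed.

(** The reciprocals [e_(n-1) / z n] solve the branch recursion inside
    [[-1, 1]].  The condition is on [|z n|] and not on [z n], so the statement
    also applies to the orbit of a conjugate. *)
Lemma ecf_int_unique d (z : nat -> R) :
  (forall n, admissible (d n)) -> (forall n, 1 <= Rabs (z n)) ->
  (forall n, z n = IZR (fst (d n)) + IZR (snd (d n)) / z (S n)) ->
  z 0%nat = ecf_int d.
Proof.
  intros Hd Hb Hz.
  set (y := fun n => match n with O => / z 0%nat | S k => IZR (snd (d k)) / z (S k) end).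
  assert (Hnz : forall n, z n <> 0).
  { intros n E. specialize (Hb n). rewrite E, Rabs_R0 in Hb. lra. }
  assert (B : forall n, -1 <= / z n <= 1).
  { intros n. apply Rabs_le_between. rewrite Rabs_inv. rewrite <- Rinv_1.
    apply Rinv_le_contravar; [lra | apply Hb]. }
  assert (E : y 0%nat = ext_ecf (lag 1 d)).
  { apply ext_ecf_unique.
    - apply lag_admissible; auto.
    - intros [|n]; simpl; [apply B|]. unfold Rdiv. specialize (B (S n)).
      destruct (admissible_IZR _ (Hd n)) as [_ [-> | ->]]; lra.
    - intros [|n]; simpl; unfold branch; simpl; rewrite <- Hz; [field; apply Hnz|reflexivity]. }
  rewrite <- ecf_frac_lag in E by auto. rewrite ecf_frac_inv in E by exact Hd. simpl in E.
  rewrite Rmult_1_l in E. apply (f_equal Rinv) in E. rewrite !Rinv_inv in E. exact E.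
Qed.

(** * Digits of irrational numbers *)

(** Linear independence of [1] and [x] over the integers, in the form used
    throughout. *)
Lemma irrational_lin x (p q : Z) : irrational x -> IZR p * x + IZR q = 0 ->
  p = 0%Z /\ q = 0%Z.
Proof.
  intros Hx H. destruct (Z.eq_dec p 0) as [->|Hp].
  - split; [reflexivity|]. apply eq_IZR. lra.
  - exfalso. apply Hx. exists (- q)%Z, p. split; [exact Hp|].
    apply eq_IZR_contrapositive in Hp. rewrite opp_IZR. field_simplify_eq; [lra|exact Hp].
Qed.

Lemma irrational_moebius x (a b c d : Z) : irrational x -> (a * d - b * c <> 0)%Z ->
  IZR c * x + IZR d <> 0 /\ irrational ((IZR a * x + IZR b) / (IZR c * x + IZR d)).
Proof.
  intros Hx Hdet.
  assert (H : IZR c * x + IZR d <> 0).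
  { intros E. apply irrational_lin in E; [|exact Hx]. destruct E as [-> ->]. apply Hdet. ring. }
  split; [exact H|]. intros (p & q & Hq & E).
  apply eq_IZR_contrapositive in Hq as Hq'.
  assert (K : IZR (a * q - c * p) * x + IZR (b * q - d * p) = 0).
  { rewrite !minus_IZR, !mult_IZR.
    apply (f_equal (fun t => t * (IZR c * x + IZR d) * IZR q)) in E.
    field_simplify in E; [|auto..]. lra. }
  apply irrational_lin in K; [|exact Hx]. destruct K as [K1 K2].
  assert ((a * d - b * c) * q = 0)%Z by (replace ((a * d - b * c) * q)%Z with
    (d * (a * q - c * p) - c * (b * q - d * p))%Z by ring; rewrite K1, K2; ring).
  apply Z.mul_eq_0 in H0. tauto.
Qed.

Lemma irrational_not_IZR x (k : Z) : irrational x -> x <> IZR k.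
Proof. intros H ->. apply H. exists k, 1%Z. split; [lia|]. lra. Qed.

Lemma irrational_inv x : irrational x -> irrational (/ x).
Proof.
  intros H. destruct (irrational_moebius x 0 1 1 0 H) as [_ K]; [lia|].
  replace (/ x) with ((0 * x + 1) / (1 * x + 0)); [exact K|].
  field. apply irrational_not_IZR, H.
Qed.

Lemma irrational_step x (e a : Z) : e <> 0%Z -> irrational x ->
  irrational (IZR e / (x - IZR a)).
Proof.
  intros He H. destruct (irrational_moebius x 0 e 1 (-a) H) as [_ K]; [lia|].
  rewrite opp_IZR in K.
  replace (IZR e / (x - IZR a)) with ((0 * x + IZR e) / (1 * x + - IZR a)); [exact K|].
  field. pose proof (irrational_not_IZR x a H). lra.
Qed.

Definition near_even (x : R) : Z := (2 * Int_part ((x + 1) / 2))%Z.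

Lemma near_even_bound x : irrational x -> -1 < x - IZR (near_even x) < 1.
Proof.
  intros H. unfold near_even. rewrite mult_IZR.
  destruct (base_Int_part ((x + 1) / 2)) as [H1 H2].
  set (k := Int_part ((x + 1) / 2)) in *.
  pose proof (irrational_not_IZR x (2 * k - 1) H) as N1.
  rewrite minus_IZR, mult_IZR in N1. lra.
Qed.

Lemma Even_near_even x : Z.Even (near_even x).
Proof. exists (Int_part ((x + 1) / 2)). reflexivity. Qed.

(** One of the two distances may be equal to one: the even integers are then
    still less than two apart. *)
Lemma even_integer_unique x (a b : Z) : Z.Even a -> Z.Even b ->
  -1 <= x - IZR a <= 1 -> -1 < x - IZR b < 1 -> a = b.
Proof.
  intros [k ->] [m ->] Ha Hb.
  rewrite mult_IZR in *.
  assert (IZR (k - m) < 1) by (rewrite minus_IZR; lra).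
  assert (-1 < IZR (k - m)) by (rewrite minus_IZR; lra).
  apply lt_IZR in H, H0. lia.
Qed.

Definition next_digit (x : R) : digit :=
  (near_even x, if Rle_dec 0 (x - IZR (near_even x)) then 1%Z else (-1)%Z).

Definition gauss_map (x : R) : R := / Rabs (x - IZR (near_even x)).

Lemma gauss_map_spec x : irrational x -> 1 < x ->
  irrational (gauss_map x) /\ 1 < gauss_map x /\ admissible (next_digit x) /\
  x = IZR (fst (next_digit x)) + IZR (snd (next_digit x)) / gauss_map x.
Proof.
  intros Hx H1. pose proof (near_even_bound x Hx) as B.
  pose proof (irrational_not_IZR x (near_even x) Hx) as N.
  assert (Pos : 0 < Rabs (x - IZR (near_even x)) < 1).
  { split; [apply Rabs_pos_lt; lra | apply Rabs_def1; lra]. }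
  assert (E : 0 < IZR (near_even x)) by lra. apply lt_IZR in E.
  split; [|split; [|split]].
  - unfold gauss_map, Rabs. destruct Rcase_abs.
    + pose proof (irrational_step x (-1) (near_even x) ltac:(lia) Hx) as K.
      replace (/ _) with (-1 / (x - IZR (near_even x))); [exact K | field; lra].
    + pose proof (irrational_step x 1 (near_even x) ltac:(lia) Hx) as K.
      unfold Rdiv in K. rewrite Rmult_1_l in K. exact K.
  - unfold gauss_map. rewrite <- Rinv_1 at 1. apply Rinv_lt_contravar; lra.
  - unfold next_digit. split; [exact E|]. split; [apply Even_near_even|].
    simpl. destruct Rle_dec; auto.
  - unfold next_digit, gauss_map, Rdiv. rewrite Rinv_inv. simpl.
    destruct Rle_dec; [rewrite Rabs_pos_eq by lra | rewrite Rabs_left by lra]; ring.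
Qed.

Lemma ecf_int_exists x : irrational x -> 1 < x ->
  exists d, (forall n, admissible (d n)) /\ x = ecf_int d.
Proof.
  intros Hx H1. set (z := fun n => Nat.iter n gauss_map x).
  assert (Hz : forall n, irrational (z n) /\ 1 < z n).
  { induction n; [auto|]. split; apply gauss_map_spec; apply IHn. }
  exists (fun n => next_digit (z n)). split.
  - intros n. apply gauss_map_spec; apply Hz.
  - apply (ecf_int_unique _ z).
    + intros n. apply gauss_map_spec; apply Hz.
    + intros n. destruct (Hz n). rewrite Rabs_pos_eq; lra.
    + intros n. apply gauss_map_spec; apply Hz.
Qed.

Lemma ecf_next d : (forall n, admissible (d n)) ->
  ecf_int (skip 1 d) = IZR (snd (d 0%nat)) / (ecf_int d - IZR (fst (d 0%nat))).
Proof.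
  intros Hd. rewrite (ecf_int_step d Hd) at 1.
  pose proof (ecf_int_ge_1 _ (skip_admissible 1 d Hd)).
  destruct (admissible_IZR _ (Hd 0%nat)) as [_ [-> | ->]]; field; lra.
Qed.

Lemma ecf_int_irrational_skip d n : (forall n, admissible (d n)) ->
  irrational (ecf_int d) -> irrational (ecf_int (skip n d)).
Proof.
  intros Hd H. induction n; [exact H|].
  replace (S n) with (n + 1)%nat by lia. rewrite <- skip_skip.
  rewrite ecf_next by (apply skip_admissible, Hd).
  apply irrational_step; [|exact IHn].
  pose proof (Hd (n + 0)%nat) as (_ & _ & [E|E]); unfold skip; rewrite E; lia.
Qed.

Lemma ecf_int_gt_1 d : (forall n, admissible (d n)) ->
  irrational (ecf_int d) -> 1 < ecf_int d.
Proof.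
  intros Hd H. pose proof (ecf_int_ge_1 d Hd). pose proof (irrational_not_IZR _ 1 H). lra.
Qed.

Lemma ecf_first_digit d : (forall n, admissible (d n)) -> irrational (ecf_int d) ->
  -1 < ecf_int d - IZR (fst (d 0%nat)) < 1 /\
  ecf_int d - IZR (fst (d 0%nat)) = IZR (snd (d 0%nat)) / ecf_int (skip 1 d).
Proof.
  intros Hd H.
  pose proof (ecf_int_gt_1 _ (skip_admissible 1 d Hd) (ecf_int_irrational_skip d 1 Hd H)) as G.
  assert (E : ecf_int d - IZR (fst (d 0%nat)) = IZR (snd (d 0%nat)) / ecf_int (skip 1 d)).
  { rewrite (ecf_int_step d Hd) at 1. ring. }
  split; [|exact E]. rewrite E.
  assert (0 < / ecf_int (skip 1 d) < 1).
  { split; [apply Rinv_0_lt_compat; lra|]. rewrite <- Rinv_1.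
    apply Rinv_lt_contravar; lra. }
  unfold Rdiv. destruct (admissible_IZR _ (Hd 0%nat)) as [_ [-> | ->]]; lra.
Qed.

(** Since [x - a_1 = e_1 / x_2] with [x_2 > 1], the first digit is forced: [a_1]
    is the even integer nearest to [x], and [e_1] is the sign of [x - a_1]. *)
Lemma ecf_int_inj d d' : (forall n, admissible (d n)) -> (forall n, admissible (d' n)) ->
  irrational (ecf_int d) -> ecf_int d = ecf_int d' -> forall n, d n = d' n.
Proof.
  intros Hd Hd' Hirr E n. revert d d' Hd Hd' Hirr E.
  assert (First : forall d d', (forall n, admissible (d n)) -> (forall n, admissible (d' n)) ->
    irrational (ecf_int d) -> ecf_int d = ecf_int d' -> d 0%nat = d' 0%nat).
  { intros d d' Hd Hd' Hirr E.
    destruct (ecf_first_digit d Hd Hirr) as [B1 E1].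
    pose proof Hirr as Hirr'. rewrite E in Hirr'.
    destruct (ecf_first_digit d' Hd' Hirr') as [B2 E2].
    assert (Ef : fst (d 0%nat) = fst (d' 0%nat)).
    { apply (even_integer_unique (ecf_int d)); [apply Hd | apply Hd' | lra | lra]. }
    rewrite E, Ef, E2 in E1.
    assert (0 < / ecf_int (skip 1 d)).
    { apply Rinv_0_lt_compat. pose proof (ecf_int_ge_1 _ (skip_admissible 1 d Hd)). lra. }
    assert (0 < / ecf_int (skip 1 d')).
    { apply Rinv_0_lt_compat. pose proof (ecf_int_ge_1 _ (skip_admissible 1 d' Hd')). lra. }
    destruct (d 0%nat) as [a e] eqn:D, (d' 0%nat) as [a' e'] eqn:D'. simpl in *. f_equal; [exact Ef|].
    unfold Rdiv in E1.
    pose proof (Hd 0%nat) as (_ & _ & He). pose proof (Hd' 0%nat) as (_ & _ & He').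
    rewrite D in He. rewrite D' in He'. simpl in *.
    destruct He as [-> | ->], He' as [-> | ->]; auto; lra. }
  induction n; intros d d' Hd Hd' Hirr E; [auto|].
  apply (IHn (skip 1 d) (skip 1 d')); try (apply skip_admissible; assumption).
  - apply ecf_int_irrational_skip; assumption.
  - rewrite !ecf_next by assumption. rewrite E, (First d d') by assumption. reflexivity.
Qed.

Lemma ecf_digits_spec x : irrational x -> 0 < x -> ecf_expansion (ecf_digits x) x.
Proof.
  intros Hx H0. unfold ecf_digits. apply epsilon_spec.
  destruct (Rlt_dec 1 x) as [H1|H1].
  - destruct (ecf_int_exists x Hx H1) as (d & Hd & E). exists d. split; auto.
  - destruct (ecf_int_exists (/ x)) as (d & Hd & E).
    + apply irrational_inv, Hx.
    + pose proof (irrational_not_IZR x 1 Hx). rewrite <- Rinv_1 at 1.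
      apply Rinv_lt_contravar; lra.
    + exists d. split; [exact Hd|]. left. split; [lra|].
      rewrite ecf_frac_inv by exact Hd. rewrite <- E, Rinv_inv. reflexivity.
Qed.

Lemma ecf_digits_gt_1 x : irrational x -> 1 < x ->
  (forall n, admissible (ecf_digits x n)) /\ x = ecf_int (ecf_digits x).
Proof.
  intros Hx H1. destruct (ecf_digits_spec x Hx) as [H [[? ?]|[_ ?]]]; [lra | lra | auto].
Qed.

(** * Conjugate surds *)

(** Eliminating [x^2] between two integral equations of an irrational [x]
    leaves a linear one, which must vanish; so the equations are proportional,
    and by Vieta they have the same second root. *)
Lemma is_conjugate_unique x y z : irrational x ->
  is_conjugate x y -> is_conjugate x z -> y = z.
Proof.
  intros Hx (A & B & C & HA & Rx & Ry & Ny) (A' & B' & C' & HA' & Rx' & Rz & Nz).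
  unfold is_root in *.
  assert (V : IZR A * (x + y) + IZR B = 0).
  { apply (Rmult_eq_reg_l (y - x)); [|lra]. nra. }
  assert (V' : IZR A' * (x + z) + IZR B' = 0).
  { apply (Rmult_eq_reg_l (z - x)); [|lra]. nra. }
  assert (K : IZR (A' * B - A * B') * x + IZR (A' * C - A * C') = 0).
  { rewrite !minus_IZR, !mult_IZR.
    replace ((IZR A' * IZR B - IZR A * IZR B') * x + (IZR A' * IZR C - IZR A * IZR C')) with
      (IZR A' * (IZR A * x ^ 2 + IZR B * x + IZR C)
       - IZR A * (IZR A' * x ^ 2 + IZR B' * x + IZR C')) by ring.
    rewrite Rx, Rx'. ring. }
  apply irrational_lin in K; [|exact Hx]. destruct K as [K _].
  apply (f_equal IZR) in K. rewrite minus_IZR, !mult_IZR in K.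
  apply eq_IZR_contrapositive in HA, HA'.
  apply (Rmult_eq_reg_l (IZR A * IZR A')); [|apply Rmult_integral_contrapositive; auto].
  nra.
Qed.

Lemma surd_conj_eq x y : irrational x -> is_conjugate x y -> surd_conj x = y.
Proof.
  intros Hx H. apply (is_conjugate_unique x); [exact Hx| |exact H].
  unfold surd_conj. apply epsilon_spec. exists y. exact H.
Qed.

(** The coefficients and the discriminant are kept explicit because the
    finiteness argument counts coefficient triples of a given discriminant. *)
Definition surd_pair (D : Z) (F : Z * Z * Z) (x y : R) : Prop :=
  let '(A, B, C) := F in
  (B * B - 4 * A * C = D)%Z /\ A <> 0%Z /\
  is_root A B C x /\ is_root A B C y /\ y <> x.

Lemma surd_pair_conjugate D F x y : surd_pair D F x y -> is_conjugate x y.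
Proof.
  destruct F as [[A B] C]. intros (_ & HA & Hx & Hy & N). exists A, B, C. auto.
Qed.

Lemma quadratic_surd_pair x : quadratic_surd x ->
  exists D F, surd_pair D F x (surd_conj x).
Proof.
  intros [Hx (A & B & C & HA & Rx)].
  set (y := - IZR B / IZR A - x).
  apply eq_IZR_contrapositive in HA as HA'.
  assert (Ry : is_root A B C y).
  { unfold is_root, y in *. rewrite <- Rx. field. exact HA'. }
  assert (Ny : y <> x).
  { unfold y. intros E.
    assert (K : IZR (2 * A) * x + IZR B = 0).
    { rewrite mult_IZR. rewrite <- E at 1.
      apply (Rmult_eq_compat_l (IZR A)) in E. field_simplify in E; [|exact HA'].
      field_simplify; [|exact HA']. lra. }
    apply irrational_lin in K; [|exact Hx]. lia. }
  rewrite (surd_conj_eq x y Hx); [|exists A, B, C; auto].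
  exists (B * B - 4 * A * C)%Z, (A, B, C). repeat split; auto.
Qed.

Lemma surd_pair_vieta D A B C x y : surd_pair D (A, B, C) x y ->
  IZR B = - IZR A * (x + y) /\ IZR C = IZR A * (x * y).
Proof.
  intros (_ & HA & Rx & Ry & N). unfold is_root in *.
  assert (V : IZR B = - IZR A * (x + y)).
  { apply (Rmult_eq_reg_l (y - x)); [|lra]. nra. }
  split; [exact V|]. rewrite V in Rx. nra.
Qed.

Lemma surd_pair_irrational D F x y : irrational x -> surd_pair D F x y -> irrational y.
Proof.
  destruct F as [[A B] C]. intros Hx H. destruct (surd_pair_vieta _ _ _ _ _ _ H) as [V _].
  destruct H as (_ & HA & _).
  intros (p & q & Hq & ->). apply Hx. exists (- B * q - A * p)%Z, (A * q)%Z.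
  split; [lia|]. apply eq_IZR_contrapositive in HA, Hq.
  rewrite minus_IZR, !mult_IZR, opp_IZR, V. field. auto.
Qed.

(** The equation for [z' = e / (z - a)], obtained by substituting
    [z = a + e / z'] and clearing denominators. *)
Definition form_step (d : digit) (F : Z * Z * Z) : Z * Z * Z :=
  let '(A, B, C) := F in let (a, e) := d in
  ((A * a * a + B * a + C), (e * (2 * A * a + B)), A)%Z.

Lemma surd_pair_step D F d x y : snd d = 1%Z \/ snd d = (-1)%Z -> irrational x -> surd_pair D F x y ->
  surd_pair D (form_step d F)
    (IZR (snd d) / (x - IZR (fst d))) (IZR (snd d) / (y - IZR (fst d))).
Proof.
  intros Hd Hx H. pose proof (surd_pair_irrational _ _ _ _ Hx H) as Hy.
  destruct F as [[A B] C]. destruct d as [a e].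
  pose proof (irrational_not_IZR _ a Hx) as Nx. pose proof (irrational_not_IZR _ a Hy) as Ny.
  rename Hd into He. cbn [fst snd form_step] in He |- *.
  destruct (surd_pair_vieta _ _ _ _ _ _ H) as [V1 V2].
  destruct H as (HD & HA & Rx & Ry & N). unfold is_root in *.
  apply eq_IZR_contrapositive in HA as HA'.
  assert (Q : IZR (A * a * a + B * a + C) = IZR A * ((x - IZR a) * (y - IZR a))).
  { rewrite !plus_IZR, !mult_IZR, V1, V2. ring. }
  assert (Ee : (e * e = 1)%Z) by (destruct He as [-> | ->]; reflexivity).
  assert (Ee' : IZR e * IZR e = 1) by (rewrite <- mult_IZR, Ee; reflexivity).
  assert (Ne : IZR e <> 0) by (intros E0; rewrite E0 in Ee'; lra).
  assert (M : IZR (e * (2 * A * a + B)) = IZR e * (IZR A * (2 * IZR a - x - y))).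
  { rewrite !mult_IZR, plus_IZR, !mult_IZR, V1. ring. }
  unfold surd_pair, is_root. split; [|split; [|split; [|split]]].
  - transitivity (e * e * (B * B - 4 * A * C) + (e * e - 1) * (4 * A * (A * a * a + B * a + C)))%Z;
      [ring|]. rewrite Ee, HD. ring.
  - intros E. rewrite E in Q. symmetry in Q.
    apply Rmult_integral in Q. destruct Q as [Q|Q]; [auto|].
    apply Rmult_integral in Q. destruct Q; lra.
  - rewrite Q, M.
    replace (_ + _) with ((IZR e * IZR e - 1) * (IZR A * (2 * IZR a - x - y)) / (x - IZR a)
      + (IZR e * IZR e - 1) * (IZR A * (y - IZR a)) / (x - IZR a)
      + (IZR A * (y - IZR a)) / (x - IZR a) + (IZR A * (2 * IZR a - x - y)) / (x - IZR a) + IZR A)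
      by (field; lra).
    rewrite Ee'. field. lra.
  - rewrite Q, M.
    replace (_ + _) with ((IZR e * IZR e - 1) * (IZR A * (2 * IZR a - x - y)) / (y - IZR a)
      + (IZR e * IZR e - 1) * (IZR A * (x - IZR a)) / (y - IZR a)
      + (IZR A * (x - IZR a)) / (y - IZR a) + (IZR A * (2 * IZR a - x - y)) / (y - IZR a) + IZR A)
      by (field; lra).
    rewrite Ee'. field. lra.
  - intros E. apply N.
    apply (f_equal (fun t => t * (x - IZR a) * (y - IZR a) / IZR e)) in E.
    field_simplify in E; [lra | |]; repeat split; auto; lra.
Qed.

(** With [u = B - (A + C)] and [v = B + (A + C)], the product [u v] is
    [- f(1) f(-1)], positive because exactly one root lies in [(-1, 1)] and the
    other one is beyond [1], and [u v + (A - C)^2 = D].  A positive integer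
    product bounds both factors. *)
Lemma reduced_bounded D A B C x y : surd_pair D (A, B, C) x y -> 1 < x -> -1 < y < 1 ->
  (- D <= A <= D /\ - D <= B <= D /\ - D <= C <= D)%Z.
Proof.
  intros H Hx Hy. destruct (surd_pair_vieta _ _ _ _ _ _ H) as [V1 V2].
  destruct H as (HD & HA & _).
  assert (P : IZR ((B - (A + C)) * (B + (A + C))) = IZR A ^ 2 * ((x - 1) * (x + 1) * ((1 - y) * (1 + y)))).
  { rewrite mult_IZR, minus_IZR, !plus_IZR, V1, V2. ring. }
  assert (0 < IZR ((B - (A + C)) * (B + (A + C)))).
  { rewrite P. apply eq_IZR_contrapositive in HA. apply Rmult_lt_0_compat; [apply pow2_gt_0, HA|].
    repeat apply Rmult_lt_0_compat; lra. }
  apply lt_IZR in H.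
  set (u := (B - (A + C))%Z) in *. set (v := (B + (A + C))%Z) in *.
  assert (HD' : (u * v + (A - C) * (A - C) = D)%Z) by (unfold u, v; rewrite <- HD; ring).
  assert (Habs : (Z.abs u * Z.abs v = u * v)%Z) by (rewrite <- Z.abs_mul; apply Z.abs_eq; lia).
  assert (Hu : (1 <= Z.abs u)%Z) by (destruct (Z.eq_dec u 0); subst; lia).
  assert (Hv : (1 <= Z.abs v)%Z) by (destruct (Z.eq_dec v 0); subst; lia).
  assert (Hw : (Z.abs (A - C) <= (A - C) * (A - C))%Z).
  { rewrite <- (Z.abs_square (A - C)). pose proof (Z.abs_nonneg (A - C)).
    generalize dependent (Z.abs (A - C)). clear. intros w Hw. nia. }
  assert (Hu' : (Z.abs u <= Z.abs u * Z.abs v)%Z) by nia.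
  assert (Hv' : (Z.abs v <= Z.abs u * Z.abs v)%Z) by nia.
  pose proof (Z.square_nonneg (A - C)).
  assert (Z.abs u <= D)%Z by lia. assert (Z.abs v <= D)%Z by lia.
  assert (Z.abs (A - C) <= D)%Z by lia.
  clear Habs Hu Hv HD' Hu' Hv' Hw.
  unfold u, v in *. lia.
Qed.

(** * Reduced surds *)

(** The steps prescribed by the digits of one number, applied to any real
    starting point; used for the number itself and for its conjugate. *)
Fixpoint digit_orbit (d : nat -> digit) (y : R) (n : nat) : R :=
  match n with
  | O => y
  | S n' => IZR (snd (d n')) / (digit_orbit d y n' - IZR (fst (d n')))
  end.

Lemma digit_orbit_ecf d n : (forall n, admissible (d n)) ->
  digit_orbit d (ecf_int d) n = ecf_int (skip n d).
Proof.
  intros Hd. induction n; [reflexivity|].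
  replace (S n) with (n + 1)%nat at 2 by lia. rewrite <- skip_skip.
  rewrite ecf_next by (apply skip_admissible, Hd).
  cbn [digit_orbit]. rewrite IHn. unfold skip. rewrite Nat.add_0_r. reflexivity.
Qed.

Fixpoint form_orbit (d : nat -> digit) (F : Z * Z * Z) (n : nat) : Z * Z * Z :=
  match n with
  | O => F
  | S n' => form_step (d n') (form_orbit d F n')
  end.

Lemma surd_pair_orbit D F d x y n : (forall n, admissible (d n)) -> irrational x ->
  surd_pair D F x y ->
  irrational (digit_orbit d x n) /\ irrational (digit_orbit d y n) /\
  surd_pair D (form_orbit d F n) (digit_orbit d x n) (digit_orbit d y n).
Proof.
  intros Hd Hx H. induction n.
  - split; [exact Hx|]. split; [eapply surd_pair_irrational; eauto | exact H].
  - destruct IHn as (Ix & Iy & IH).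
    assert (Ne : snd (d n) <> 0%Z) by (destruct (Hd n) as (_ & _ & [-> | ->]); lia).
    cbn [digit_orbit form_orbit]. split; [|split].
    + apply irrational_step; assumption.
    + apply irrational_step; assumption.
    + apply surd_pair_step; [apply Hd | assumption..].
Qed.

Lemma reduced_step d y : admissible d -> -1 < y < 1 ->
  -1 < IZR (snd d) / (y - IZR (fst d)) < 1.
Proof.
  intros Hd Hy. destruct (admissible_IZR _ Hd) as [Ha He].
  apply Rabs_lt_between. rewrite Rabs_div by lra. rewrite (Rabs_left (_ - _)) by lra.
  apply Rlt_div_l; [lra|].
  assert (Rabs (IZR (snd d)) = 1) as ->.
  { destruct He as [-> | ->]; [apply Rabs_R1 | rewrite Rabs_left; lra]. }
  lra.
Qed.

(** The second index is written [p + i] because [p] will become a period. *)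
Lemma pigeonhole_list {T : Type} (f : nat -> T) (L : list T) :
  (forall n, In (f n) L) -> exists i p, (0 < p)%nat /\ f i = f (p + i)%nat.
Proof.
  intros H. destruct (excluded_middle_informative
    (exists i p, (0 < p)%nat /\ f i = f (p + i)%nat)) as [E|N]; [exact E|exfalso].
  assert (Inj : Injective f).
  { intros i j E. destruct (Nat.lt_trichotomy i j) as [K|[K|K]]; [|exact K|].
    - exfalso. apply N. exists i, (j - i)%nat. split; [lia|].
      replace (j - i + i)%nat with j by lia. exact E.
    - exfalso. apply N. exists j, (i - j)%nat. split; [lia|].
      replace (i - j + j)%nat with i by lia. auto. }
  pose proof (Injective_map_NoDup Inj (seq_NoDup (S (length L)) 0)) as ND.
  apply (NoDup_incl_length (l' := L)) in ND.
  - rewrite length_map, length_seq in ND. lia.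
  - intros t Ht. apply in_map_iff in Ht. destruct Ht as [k [<- _]]. apply H.
Qed.

Definition Z_range (D : Z) : list Z :=
  map (fun k => (Z.of_nat k - D)%Z) (seq 0 (Z.to_nat (2 * D + 1))).

Lemma in_Z_range D A : (- D <= A <= D)%Z -> In A (Z_range D).
Proof.
  intros H. apply in_map_iff. exists (Z.to_nat (A + D)). split; [lia|].
  apply in_seq. lia.
Qed.

Lemma surd_pair_same_form D F x y x' y' : surd_pair D F x y -> surd_pair D F x' y' ->
  1 < x -> -1 < y < 1 -> 1 < x' -> -1 < y' < 1 -> x = x' /\ y = y'.
Proof.
  destruct F as [[A B] C]. intros H H' Hx Hy Hx' Hy'.
  destruct (surd_pair_vieta _ _ _ _ _ _ H) as [V1 V2].
  destruct (surd_pair_vieta _ _ _ _ _ _ H') as [V1' V2'].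
  destruct H as (_ & HA & _). apply eq_IZR_contrapositive in HA.
  assert (S : x + y = x' + y') by (apply (Rmult_eq_reg_l (IZR A)); lra).
  assert (P : x * y = x' * y') by (apply (Rmult_eq_reg_l (IZR A)); lra).
  assert (Q : (x - x') * (x - y') = 0) by nra.
  apply Rmult_integral in Q. destruct Q; lra.
Qed.

(** The pair of a number and its conjugate can be traced backwards: since
    [y - a < 0], the sign of [e / (y - a)] gives [e], and then [y - a]
    determines the even number [a], as [-1 < y < 1]. *)
Lemma reduced_back d d' y y' : admissible d -> admissible d' ->
  -1 < y < 1 -> -1 < y' < 1 ->
  IZR (snd d) / (y - IZR (fst d)) = IZR (snd d') / (y' - IZR (fst d')) ->
  d = d' /\ y = y'.
Proof.
  intros Hd Hd' Hy Hy' E.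
  destruct (admissible_IZR _ Hd) as [Ha He]. destruct (admissible_IZR _ Hd') as [Ha' He'].
  assert (S : snd d = snd d' /\ y - IZR (fst d) = y' - IZR (fst d')).
  { assert (P : 0 < / (IZR (fst d) - y)) by (apply Rinv_0_lt_compat; lra).
    assert (P' : 0 < / (IZR (fst d') - y')) by (apply Rinv_0_lt_compat; lra).
    assert (E2 : IZR (snd d) * / (IZR (fst d) - y) = IZR (snd d') * / (IZR (fst d') - y')).
    { transitivity (- (IZR (snd d) / (y - IZR (fst d)))); [field; lra|].
      rewrite E. field; lra. }
    assert (ES : IZR (snd d) = IZR (snd d')) by
      (destruct He as [He | He], He' as [He' | He']; rewrite He, He' in *; lra).
    split; [apply eq_IZR, ES|].
    assert (E3 : / (IZR (fst d) - y) = / (IZR (fst d') - y')).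
    { rewrite ES in E2. apply Rmult_eq_reg_l in E2; [exact E2|]. destruct He'; lra. }
    apply (f_equal Rinv) in E3. rewrite !Rinv_inv in E3. lra. }
  destruct S as [S1 S2].
  assert (fst d = fst d').
  { destruct Hd as (_ & [k Hk] & _). destruct Hd' as (_ & [m Hm] & _).
    rewrite Hk, Hm in *.
    assert (IZR (2 * k - 2 * m) < 2) by (rewrite minus_IZR; lra).
    assert (-2 < IZR (2 * k - 2 * m)) by (rewrite minus_IZR; lra).
    apply lt_IZR in H, H0. lia. }
  split; [|rewrite H in S2; lra].
  destruct d, d'. simpl in *. congruence.
Qed.

(** Two members of the orbit have the same equation, hence coincide, because a
    reduced pair is determined by its equation.  Tracing back moves the
    coincidence to the beginning. *)
Lemma reduced_purely_periodic d y : (forall n, admissible (d n)) ->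
  irrational (ecf_int d) -> is_conjugate (ecf_int d) y -> -1 < y < 1 ->
  exists p, (0 < p)%nat /\ forall n, d (p + n)%nat = d n.
Proof.
  intros Hd Hx (A & B & C & HA & Rx & Ry & N) Hy.
  set (x := ecf_int d) in *. set (D := (B * B - 4 * A * C)%Z).
  assert (H : surd_pair D (A, B, C) x y) by (repeat split; assumption).
  pose proof (surd_pair_orbit D (A, B, C) d x y) as O.
  assert (G : forall n, 1 < digit_orbit d x n).
  { intros n. unfold x. rewrite digit_orbit_ecf by exact Hd.
    apply ecf_int_gt_1; [apply skip_admissible, Hd | apply ecf_int_irrational_skip; assumption]. }
  assert (Red : forall n, -1 < digit_orbit d y n < 1).
  { induction n; [exact Hy|]. apply reduced_step; auto. }
  destruct (pigeonhole_list (form_orbit d (A, B, C))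
    (list_prod (list_prod (Z_range D) (Z_range D)) (Z_range D))) as (i & p & Hp & E).
  { intros n. destruct (O n Hd Hx H) as (_ & _ & P).
    destruct (form_orbit d (A, B, C) n) as [[An Bn] Cn].
    destruct (reduced_bounded _ _ _ _ _ _ P (G n) (Red n)) as (BA & BB & BC).
    repeat apply in_prod; apply in_Z_range; assumption. }
  exists p. split; [exact Hp|].
  assert (K : digit_orbit d x i = digit_orbit d x (p + i) /\ digit_orbit d y i = digit_orbit d y (p + i)).
  { destruct (O i Hd Hx H) as (_ & _ & P). destruct (O (p + i)%nat Hd Hx H) as (_ & _ & P').
    rewrite E in P. eapply surd_pair_same_form; eauto. }
  clear E. revert K. induction i; intros [Kx Ky].
  - intros n. rewrite Nat.add_0_r in Kx. unfold x in Kx. rewrite !digit_orbit_ecf in Kx by exact Hd.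
    symmetry. apply (ecf_int_inj (skip 0 d) (skip p d)); auto using skip_admissible.
  - apply IHi. rewrite Nat.add_succ_r in Kx, Ky. cbn [digit_orbit] in Ky.
    destruct (reduced_back _ _ _ _ (Hd i) (Hd (p + i)%nat) (Red _) (Red _) Ky) as [Ed Ey].
    split; [|exact Ey].
    assert (M : forall k, digit_orbit d x k = IZR (fst (d k)) + IZR (snd (d k)) / digit_orbit d x (S k)).
    { intros k. unfold x. rewrite !digit_orbit_ecf by exact Hd.
      rewrite (ecf_int_step (skip k d)) by (apply skip_admissible, Hd).
      rewrite skip_skip. unfold skip. rewrite Nat.add_0_r, Nat.add_1_r. reflexivity. }
    rewrite (M i), (M (p + i)%nat), Ed, Kx. reflexivity.
Qed.

(** If [y] were never reduced, its orbit would stay outside [(-1, 1)] just as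
    that of [x] does, and both would start at the value of the same digits. *)
Lemma digit_orbit_eventually_reduced d y : (forall n, admissible (d n)) ->
  irrational (ecf_int d) -> irrational y -> y <> ecf_int d ->
  exists n, -1 < digit_orbit d y n < 1.
Proof.
  intros Hd Hx Iy N.
  destruct (excluded_middle_informative (exists n, -1 < digit_orbit d y n < 1)) as [E|NE];
    [exact E|exfalso].
  apply N. apply (ecf_int_unique d (digit_orbit d y)).
  - exact Hd.
  - intros n. apply Rnot_lt_le. intros L. apply NE. exists n.
    apply Rabs_lt_between. exact L.
  - assert (I : forall n, irrational (digit_orbit d y n)).
    { induction n; [exact Iy|]. apply irrational_step; [|exact IHn].
      destruct (Hd n) as (_ & _ & [-> | ->]); lia. }
    intros n. cbn [digit_orbit]. pose proof (irrational_not_IZR _ (fst (d n)) (I n)).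
    destruct (admissible_IZR _ (Hd n)) as [_ [-> | ->]]; field; lra.
Qed.

(** * Periodic digit sequences *)

Lemma cycle_admissible l : is_block l -> forall n, admissible (cycle l n).
Proof.
  intros [Hl H] n. apply (proj1 (Forall_forall _ _) H). apply nth_In.
  apply Nat.mod_upper_bound. destruct l; [contradiction|discriminate].
Qed.

Lemma cycle_period l : l <> [] -> skip (length l) (cycle l) = cycle l.
Proof.
  intros Hl. apply functional_extensionality. intros n. unfold skip, cycle. f_equal.
  rewrite <- (Nat.mul_1_l (length l)) at 1. rewrite Nat.add_comm.
  apply Nat.Div0.mod_add.
Qed.

Lemma cycle_prefix l : prefix (length l) (cycle l) = l.
Proof.
  unfold prefix. apply (nth_ext _ _ (2, 1)%Z (2, 1)%Z).
  - rewrite length_map, length_seq. reflexivity.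
  - intros n Hn. rewrite length_map, length_seq in Hn.
    rewrite (nth_indep _ _ (cycle l 0)) by (rewrite length_map, length_seq; exact Hn).
    rewrite map_nth, seq_nth by exact Hn. unfold cycle. simpl.
    rewrite Nat.mod_small by exact Hn. reflexivity.
Qed.

Lemma periodic_cycle d p : (0 < p)%nat -> (forall n, d (p + n)%nat = d n) ->
  d = cycle (prefix p d).
Proof.
  intros Hp H. apply functional_extensionality. intros n.
  unfold cycle. rewrite prefix_length.
  assert (K : forall q m, d (q * p + m)%nat = d m).
  { induction q; intros m; [reflexivity|].
    replace (S q * p + m)%nat with (p + (q * p + m))%nat by lia. rewrite H. apply IHq. }
  rewrite (Nat.div_mod n p) at 1 by lia. rewrite Nat.mul_comm, K.
  pose proof (Nat.mod_upper_bound n p ltac:(lia)) as B.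
  unfold prefix.
  rewrite (nth_indep _ _ (d 0%nat)) by (rewrite length_map, length_seq; exact B).
  rewrite map_nth, seq_nth by exact B. reflexivity.
Qed.

Lemma prefix_block d p : (0 < p)%nat -> (forall n, admissible (d n)) -> is_block (prefix p d).
Proof.
  intros Hp Hd. split; [|apply prefix_admissible, Hd].
  intros E. apply (f_equal (@length _)) in E. rewrite prefix_length in E. simpl in E. lia.
Qed.

Lemma cycle_double l : l <> [] -> cycle (l ++ l) = cycle l.
Proof.
  intros Hl. rewrite (periodic_cycle (cycle l) (length (l ++ l))) at 1.
  - rewrite length_app, prefix_plus, cycle_period, cycle_prefix by exact Hl. reflexivity.
  - rewrite length_app. destruct l; [contradiction|]. simpl. lia.
  - intros n. rewrite length_app. rewrite <- Nat.add_assoc.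
    pose proof (cycle_period l Hl) as P.
    transitivity (skip (length l) (cycle l) (length l + n)); [reflexivity|].
    rewrite P. transitivity (skip (length l) (cycle l) n); [reflexivity|]. rewrite P. reflexivity.
Qed.

Lemma sign_prod_app l l' : sign_prod (l ++ l') = (sign_prod l * sign_prod l')%Z.
Proof.
  unfold sign_prod. induction l; cbn [fold_right app]; [lia|]. rewrite IHl. ring.
Qed.

Lemma sign_prod_unit l : List.Forall admissible l -> sign_prod l = 1%Z \/ sign_prod l = (-1)%Z.
Proof.
  induction 1 as [|d l Hd _ IH]; [auto|]. unfold sign_prod in *. cbn [fold_right].
  destruct Hd as (_ & _ & [-> | ->]), IH as [-> | ->]; auto.
Qed.

(** Doubling a block changes neither expansion and squares its sign, so a
    period may always be taken to come from an element of Theta. *)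
Lemma positive_block l : is_block l -> exists l', is_block l' /\ sign_prod l' = 1%Z /\
  cycle l' = cycle l /\ cycle (rev l') = cycle (rev l).
Proof.
  intros [Hl H]. destruct (sign_prod_unit l H) as [E|E].
  - exists l. repeat split; auto.
  - exists (l ++ l). split; [|split; [|split]].
    + split; [destruct l; [contradiction|discriminate] | apply Forall_app; auto].
    + rewrite sign_prod_app, E. reflexivity.
    + apply cycle_double, Hl.
    + rewrite rev_app_distr. apply cycle_double. intros E'.
      apply Hl. rewrite <- (rev_involutive l), E'. reflexivity.
Qed.

Lemma rev_block l : is_block l -> is_block (rev l).
Proof.
  intros [Hl H]. split.
  - intros E. apply Hl. rewrite <- (rev_involutive l), E. reflexivity.
  - apply Forall_rev, H.
Qed.

(** The step [z |-> e / (z - a)] is the branch [w |-> e / (a + w)] conjugated by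
    [w |-> -w], and the steps are composed in the opposite order; this is why
    conjugation reverses the period and changes the sign. *)
Lemma digit_orbit_rev n d w :
  digit_orbit d (- w) n = - branches (rev (prefix n d)) w.
Proof.
  induction n; [reflexivity|].
  rewrite prefix_S_last, rev_app_distr. simpl. rewrite IHn.
  unfold branch. change (fold_right branch w (rev (prefix n d))) with (branches (rev (prefix n d)) w).
  replace (- branches (rev (prefix n d)) w - IZR (fst (d n))) with
    (- (IZR (fst (d n)) + branches (rev (prefix n d)) w)) by ring.
  unfold Rdiv. rewrite Rinv_opp. ring.
Qed.

Lemma ext_ecf_prefix d n : (forall n, admissible (d n)) ->
  ext_ecf d = branches (prefix n d) (ext_ecf (skip n d)).
Proof.
  intros Hd. induction n; [reflexivity|].
  rewrite prefix_S_last, branches_app. rewrite IHn. f_equal. simpl.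
  rewrite ext_ecf_branch by (apply skip_admissible, Hd).
  rewrite skip_skip, Nat.add_1_r. unfold skip. rewrite Nat.add_0_r. reflexivity.
Qed.

Lemma digit_orbit_ext_rev l : is_block l ->
  digit_orbit (cycle l) (- ext_ecf (cycle (rev l))) (length l) = - ext_ecf (cycle (rev l)).
Proof.
  intros Hl. pose proof (rev_block l Hl) as Hr.
  rewrite digit_orbit_rev, cycle_prefix. f_equal.
  rewrite (ext_ecf_prefix _ (length (rev l))) at 2 by (apply cycle_admissible, Hr).
  rewrite cycle_prefix, cycle_period by apply Hr. reflexivity.
Qed.

(** Euclidean descent: if [x_n] has denominator [q], then [x_(n+1)] has a
    denominator [q'] with [q = x_(n+1) q'], so denominators decrease until a
    complete quotient equals one. *)
Lemma rational_ecf_reaches_1 d (p q : Z) : (forall n, admissible (d n)) -> (0 < q)%Z ->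
  ecf_int d = IZR p / IZR q -> exists n, ecf_int (skip n d) = 1.
Proof.
  intros Hd Hq. remember (Z.to_nat q) as m. revert d p q Hd Hq Heqm.
  induction m as [m IH] using lt_wf_ind. intros d p q Hd Hq Hm E.
  pose proof (ecf_int_ge_1 _ (skip_admissible 1 d Hd)) as G.
  destruct (Req_dec (ecf_int (skip 1 d)) 1) as [E1|N1]; [exists 1%nat; exact E1|].
  pose proof (IZR_lt 0 q Hq) as HqR.
  (* the next complete quotient has the smaller denominator |p - a q| *)
  set (q' := Z.abs (p - fst (d 0%nat) * q)).
  assert (K : IZR q = ecf_int (skip 1 d) * IZR q').
  { pose proof (ecf_int_step d Hd) as S. rewrite E in S.
    unfold q'. rewrite abs_IZR, minus_IZR, mult_IZR.
    replace (IZR p - IZR (fst (d 0%nat)) * IZR q) with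
      (IZR q * (IZR p / IZR q - IZR (fst (d 0%nat)))) by (field; lra).
    rewrite S. replace (IZR q * _) with
      (IZR (snd (d 0%nat)) * (IZR q / ecf_int (skip 1 d))) by (field; lra).
    rewrite Rabs_mult.
    assert (Rabs (IZR (snd (d 0%nat))) = 1) as ->.
    { destruct (admissible_IZR _ (Hd 0%nat)) as [_ [-> | ->]]; [apply Rabs_R1 | rewrite Rabs_left; lra]. }
    rewrite Rabs_pos_eq; [field; lra|]. apply Rlt_le, Rdiv_lt_0_compat; lra. }
  assert (P : 0 < IZR q') by nra.
  assert (L : IZR q' < IZR q) by nra.
  apply lt_IZR in P, L.
  destruct (IH (Z.to_nat q') ltac:(lia) (skip 1 d) q q') as [n Hn]; auto using skip_admissible.
  - rewrite K. field. apply Rgt_not_eq, IZR_lt, P.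
  - exists (1 + n)%nat. rewrite skip_skip in Hn. exact Hn.
Qed.

Lemma ecf_int_1_stays d n : (forall n, admissible (d n)) -> ecf_int d = 1 ->
  ecf_int (skip n d) = 1.
Proof.
  intros Hd E. revert d Hd E. induction n; intros d Hd E; [exact E|].
  change (S n) with (1 + n)%nat. rewrite <- skip_skip. apply IHn; [apply skip_admissible, Hd|].
  pose proof (ecf_int_ge_1 _ (skip_admissible 1 d Hd)) as G.
  pose proof (ecf_int_step d Hd) as S. rewrite E in S.
  destruct (admissible_IZR _ (Hd 0%nat)) as [Ha He].
  assert (I : 0 < / ecf_int (skip 1 d) <= 1).
  { split; [apply Rinv_0_lt_compat; lra|]. rewrite <- Rinv_1. apply Rinv_le_contravar; lra. }
  unfold Rdiv in S.
  assert (I1 : / ecf_int (skip 1 d) = 1) by (destruct He as [He | He]; rewrite He in S; lra).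
  rewrite <- (Rinv_inv (ecf_int (skip 1 d))), I1. apply Rinv_1.
Qed.

(** A rational value would reach a tail equal to one.  All later tails are then
    equal to one as well, and by periodicity so is the whole value. *)
Lemma cycle_irrational l : is_block l -> 1 < ecf_int (cycle l) -> irrational (ecf_int (cycle l)).
Proof.
  intros Hl H1 (p & q & Hq & E).
  pose proof (cycle_admissible l Hl) as Hd.
  assert (exists n, ecf_int (skip n (cycle l)) = 1) as [n Hn].
  { destruct (Z_lt_le_dec 0 q).
    - eapply rational_ecf_reaches_1; eauto.
    - apply (rational_ecf_reaches_1 _ (- p) (- q)); [exact Hd | lia|].
      rewrite E, !opp_IZR. field. apply eq_IZR_contrapositive, Hq. }
  assert (P : forall k, skip (k * length l) (cycle l) = cycle l).
  { induction k; [reflexivity|]. replace (S k * length l)%nat with (k * length l + length l)%nat by lia.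
    rewrite <- skip_skip, IHk. apply cycle_period, Hl. }
  (* the constant tail is carried around the period to the beginning *)
  assert (Ln : (n <= n * length l)%nat).
  { destruct Hl as [Hl _]. destruct l; [contradiction|]. simpl. lia. }
  pose proof (ecf_int_1_stays (skip n (cycle l)) (n * length l - n) (skip_admissible n _ Hd) Hn) as Z.
  rewrite skip_skip in Z. replace (n + (n * length l - n))%nat with (n * length l)%nat in Z by lia.
  rewrite P in Z. lra.
Qed.

(** * The theta group acting on the real line *)

Definition theta_entries (a b c d : Z) : Prop :=
  (Z.odd a, Z.odd b, Z.odd c, Z.odd d) = (true, false, false, true) \/
  (Z.odd a, Z.odd b, Z.odd c, Z.odd d) = (false, true, true, false).

Lemma Theta_entries M : Theta M <-> theta_entries (ma M) (mb M) (mc M) (md M).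
Proof.
  unfold Theta, theta_entries. rewrite !Zmod_odd.
  destruct (Z.odd (ma M)), (Z.odd (mb M)), (Z.odd (mc M)), (Z.odd (md M));
    split; intros [H|H]; try discriminate H; auto.
Qed.

Lemma sl2_mul_det M N :
  ((ma M * ma N + mb M * mc N) * (mc M * mb N + md M * md N)
   - (ma M * mb N + mb M * md N) * (mc M * ma N + md M * mc N) = 1)%Z.
Proof.
  pose proof (mdet M) as H. pose proof (mdet N) as K.
  transitivity ((ma M * md M - mb M * mc M) * (ma N * md N - mb N * mc N))%Z; [ring|].
  rewrite H, K. reflexivity.
Qed.

Definition sl2_mul (M N : SL2Z) : SL2Z := mkSL2Z _ _ _ _ (sl2_mul_det M N).

Lemma sl2_inv_det M : (md M * ma M - (- mb M) * (- mc M) = 1)%Z.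
Proof. rewrite <- (mdet M). ring. Qed.

Definition sl2_inv (M : SL2Z) : SL2Z := mkSL2Z _ _ _ _ (sl2_inv_det M).

Definition sl2_one : SL2Z := mkSL2Z 1 0 0 1 eq_refl.

Lemma Theta_mul M N : Theta M -> Theta N -> Theta (sl2_mul M N).
Proof.
  rewrite !Theta_entries. unfold theta_entries. cbn [sl2_mul ma mb mc md].
  rewrite !Z.odd_add, !Z.odd_mul.
  destruct (Z.odd (ma M)), (Z.odd (mb M)), (Z.odd (mc M)), (Z.odd (md M)),
    (Z.odd (ma N)), (Z.odd (mb N)), (Z.odd (mc N)), (Z.odd (md N));
    intros [H|H] [K|K]; try discriminate H; try discriminate K; auto.
Qed.

Lemma Theta_inv M : Theta M -> Theta (sl2_inv M).
Proof.
  rewrite !Theta_entries. unfold theta_entries. cbn [sl2_inv ma mb mc md].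
  rewrite !Z.odd_opp.
  destruct (Z.odd (ma M)), (Z.odd (mb M)), (Z.odd (mc M)), (Z.odd (md M));
    intros [H|H]; try discriminate H; auto.
Qed.

Lemma Theta_one : Theta sl2_one.
Proof. left. reflexivity. Qed.

Definition act (M : SL2Z) (x : R) : R :=
  (IZR (ma M) * x + IZR (mb M)) / (IZR (mc M) * x + IZR (md M)).

Definition denom (M : SL2Z) (x : R) : R := IZR (mc M) * x + IZR (md M).

Lemma mdet_R M : IZR (ma M) * IZR (md M) - IZR (mb M) * IZR (mc M) = 1.
Proof. rewrite <- !mult_IZR, <- minus_IZR, mdet. reflexivity. Qed.

Lemma act_irrational M x : irrational x -> denom M x <> 0 /\ irrational (act M x).
Proof.
  intros H. apply irrational_moebius; [exact H|]. rewrite mdet. lia.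
Qed.

Lemma denom_mul M N x : denom N x <> 0 ->
  denom (sl2_mul M N) x = denom M (act N x) * denom N x.
Proof.
  unfold denom, act. intros H. cbn [sl2_mul mc md]. rewrite !plus_IZR, !mult_IZR.
  field. exact H.
Qed.

(** The action on the real line is partial, so the denominators have to be
    carried along. *)
Lemma act_mul M N x : denom N x <> 0 -> denom M (act N x) <> 0 ->
  act (sl2_mul M N) x = act M (act N x).
Proof.
  intros H K. pose proof (denom_mul M N x H) as E.
  change (act (sl2_mul M N) x) with
    ((IZR (ma (sl2_mul M N)) * x + IZR (mb (sl2_mul M N))) / denom (sl2_mul M N) x).
  rewrite E. unfold denom, act in *. cbn [sl2_mul ma mb].
  rewrite !plus_IZR, !mult_IZR. field. split; [exact H|].
  intros Z. apply K.
  apply (Rmult_eq_reg_r (IZR (mc N) * x + IZR (md N))); [|exact H].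
  rewrite Rmult_0_l, <- Z. field. exact H.
Qed.

Lemma act_inv M x : denom M x <> 0 ->
  denom (sl2_inv M) (act M x) = / denom M x /\ act (sl2_inv M) (act M x) = x.
Proof.
  intros H. pose proof (mdet_R M) as D.
  assert (E : denom (sl2_inv M) (act M x) = / denom M x).
  { unfold denom, act in *. cbn [sl2_inv mc md]. rewrite opp_IZR.
    transitivity ((IZR (ma M) * IZR (md M) - IZR (mb M) * IZR (mc M)) / (IZR (mc M) * x + IZR (md M)));
    [field; exact H | rewrite D; field; exact H]. }
  split; [exact E|].
  change (act (sl2_inv M) (act M x)) with
    ((IZR (ma (sl2_inv M)) * act M x + IZR (mb (sl2_inv M))) / denom (sl2_inv M) (act M x)).
  rewrite E. unfold denom, act in *. cbn [sl2_inv ma mb]. rewrite opp_IZR.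
  transitivity ((IZR (ma M) * IZR (md M) - IZR (mb M) * IZR (mc M)) * x);
    [field; exact H | rewrite D; ring].
Qed.

Lemma sign_cases (s : Z) : s = 1%Z \/ s = (-1)%Z -> IZR s = 1 \/ IZR s = -1.
Proof. intros [-> | ->]; auto. Qed.

Lemma Even_odd_false (z : Z) : Z.Even z -> Z.odd z = false.
Proof. intros [k ->]. rewrite Z.odd_mul. reflexivity. Qed.

Lemma sl2_branch_det M (k : Z) :
  ((- mc M) * (mb M - k * md M) - (- md M) * (ma M - k * mc M) = 1)%Z.
Proof. rewrite <- (mdet M). ring. Qed.

(** The map [z |-> -1 / (z - k)] after [M]. *)
Definition sl2_branch (k : Z) (M : SL2Z) : SL2Z :=
  mkSL2Z _ _ _ _ (sl2_branch_det M k).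

Lemma Theta_branch k M : Z.Even k -> Theta M -> Theta (sl2_branch k M).
Proof.
  intros Hk. apply Even_odd_false in Hk.
  rewrite !Theta_entries. unfold theta_entries. cbn [sl2_branch ma mb mc md].
  rewrite !Z.odd_opp, !Z.odd_sub, !Z.odd_mul, Hk.
  destruct (Z.odd (ma M)), (Z.odd (mb M)), (Z.odd (mc M)), (Z.odd (md M));
    intros [H|H]; try discriminate H; auto.
Qed.

Lemma act_branch k M x : denom M x <> 0 -> act M x <> IZR k ->
  denom (sl2_branch k M) x <> 0 /\ act (sl2_branch k M) x = - / (act M x - IZR k).
Proof.
  intros H K.
  assert (E : denom (sl2_branch k M) x = (act M x - IZR k) * denom M x).
  { unfold denom, act in *. cbn [sl2_branch mc md]. rewrite !minus_IZR, !mult_IZR. field. exact H. }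
  assert (N : act M x - IZR k <> 0) by lra.
  split; [rewrite E; apply Rmult_integral_contrapositive; auto|].
  change (act (sl2_branch k M) x) with
    ((IZR (ma (sl2_branch k M)) * x + IZR (mb (sl2_branch k M))) / denom (sl2_branch k M) x).
  rewrite E. cbn [sl2_branch ma mb]. rewrite !opp_IZR. unfold denom in *.
  field. split; assumption.
Qed.

Lemma prefix_sign_S n d : sign_prod (prefix (S n) d) = (- snd (d n) * sign_prod (prefix n d))%Z.
Proof.
  rewrite prefix_S_last, sign_prod_app. unfold sign_prod at 2. cbn [fold_right]. ring.
Qed.

(** Multiplying the step [z |-> e / (z - a)] by the signs [(-e_1) ... (-e_m)]
    turns it into [w |-> -1 / (w - k)] with [k] equal to [a] up to sign.  The
    upper right entry is nonzero because the last column [(b, d)] becomes [(-d, b - k d)] with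
    [|k| >= 2], which keeps [|b| <= |d|]; it certifies that the matrix of a
    period is not the identity.  The starting point is required only not to hit
    a pole, since the conjugate of a period is not yet known to be irrational
    when this is used. *)
Lemma orbit_matrix d n e : (forall k, admissible (d k)) -> e = 1%Z \/ e = (-1)%Z ->
  exists M, Theta M /\ (0 < n -> mb M <> 0%Z)%nat /\
    forall y, (forall k, (k < n)%nat -> digit_orbit d y k <> IZR (fst (d k))) ->
      denom M (IZR e * y) <> 0 /\
      act M (IZR e * y) = IZR e * IZR (sign_prod (prefix n d)) * digit_orbit d y n.
Proof.
  intros Hd He.
  enough (exists M, Theta M /\ (0 < n -> mb M <> 0%Z)%nat /\ (md M <> 0 /\ Z.abs (mb M) <= Z.abs (md M))%Z /\
    forall y, (forall k, (k < n)%nat -> digit_orbit d y k <> IZR (fst (d k))) ->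
      denom M (IZR e * y) <> 0 /\
      act M (IZR e * y) = IZR e * IZR (sign_prod (prefix n d)) * digit_orbit d y n)
    as (M & H1 & H2 & _ & H3) by (exists M; auto).
  induction n.
  - exists sl2_one. split; [apply Theta_one|]. split; [lia|]. split; [simpl; lia|].
    intros y _. unfold denom, act, sign_prod. simpl. split; [lra | field].
  - destruct IHn as (M & HM & _ & [Hd0 Hbd] & IH).
    set (s := (e * sign_prod (prefix n d))%Z).
    assert (Hs : s = 1%Z \/ s = (-1)%Z).
    { unfold s. destruct He as [-> | ->],
        (sign_prod_unit _ (prefix_admissible n d Hd)) as [-> | ->]; auto. }
    exists (sl2_branch (s * fst (d n)) M).
    pose proof (admissible_fst_ge_2 _ (Hd n)) as H2.
    split; [|split; [|split]].
    + apply Theta_branch; [|exact HM]. destruct (Hd n) as (_ & [k Hk] & _).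
      exists (s * k)%Z. rewrite Hk. ring.
    + intros _. cbn [sl2_branch mb]. lia.
    + cbn [sl2_branch mb md].
      assert (K : (2 * Z.abs (md M) <= Z.abs (s * fst (d n) * md M))%Z).
      { rewrite !Z.abs_mul. assert (Z.abs s = 1%Z) as -> by lia. nia. }
      lia.
    + intros y Hy. destruct (IH y) as [D A]; [intros k Hk; apply Hy; lia|].
      rewrite <- mult_IZR in A. fold s in A.
      assert (Hn : digit_orbit d y n <> IZR (fst (d n))) by (apply Hy; lia).
      assert (S2 : IZR s * IZR s = 1) by (destruct (sign_cases s Hs) as [-> | ->]; lra).
      destruct (act_branch (s * fst (d n)) M (IZR e * y) D) as [D' A'].
      { rewrite A, mult_IZR. intros E. apply Hn.
        apply (Rmult_eq_reg_l (IZR s)); [exact E|]. intros Z. rewrite Z in S2. lra. }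
      split; [exact D'|]. rewrite A', A. cbn [digit_orbit]. rewrite prefix_sign_S.
      rewrite !mult_IZR, opp_IZR.
      replace (IZR e * (- IZR (snd (d n)) * IZR (sign_prod (prefix n d)))) with
        (- IZR (snd (d n)) * IZR s) by (unfold s; rewrite mult_IZR; ring).
      destruct (admissible_IZR _ (Hd n)) as [_ [-> | ->]];
      destruct (sign_cases s Hs) as [-> | ->]; field; lra.
Qed.

Lemma orbit_matrix_irrational d n e : (forall k, admissible (d k)) -> e = 1%Z \/ e = (-1)%Z ->
  exists M, Theta M /\ (0 < n -> mb M <> 0%Z)%nat /\
    forall y, irrational y ->
      act M (IZR e * y) = IZR e * IZR (sign_prod (prefix n d)) * digit_orbit d y n.
Proof.
  intros Hd He. destruct (orbit_matrix d n e Hd He) as (M & H1 & H2 & H3).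
  exists M. split; [exact H1|]. split; [exact H2|].
  intros y Hy. apply H3. intros k _. apply irrational_not_IZR.
  induction k; [exact Hy|]. apply irrational_step; [|exact IHk].
  destruct (Hd k) as (_ & _ & [-> | ->]); lia.
Qed.

(** * Tails and equivalence under the theta group *)

Lemma Theta_equiv_sym x y : Theta_equiv x y -> Theta_equiv y x.
Proof.
  intros (M & HM & D & ->). fold (act M x).
  destruct (act_inv M x D) as [E1 E2].
  exists (sl2_inv M). split; [apply Theta_inv, HM|]. split; [|symmetry; exact E2].
  change (denom (sl2_inv M) (act M x) <> 0). rewrite E1. apply Rinv_neq_0_compat, D.
Qed.

Lemma Theta_equiv_trans x y z : Theta_equiv x y -> Theta_equiv y z -> Theta_equiv x z.
Proof.
  intros (M & HM & D & ->) (N & HN & D' & ->).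
  exists (sl2_mul N M). split; [apply Theta_mul; assumption|].
  split; [|symmetry; apply act_mul; assumption].
  change (denom (sl2_mul N M) x <> 0). rewrite denom_mul by exact D.
  apply Rmult_integral_contrapositive. split; assumption.
Qed.

Lemma ecf_tail_eq m x : irrational x -> 1 < x ->
  ecf_tail m x = IZR (sign_prod (prefix m (ecf_digits x))) * digit_orbit (ecf_digits x) x m.
Proof.
  intros Hx H1. destruct (ecf_digits_gt_1 x Hx H1) as [Hd E].
  unfold ecf_tail. rewrite <- (digit_orbit_ecf _ _ Hd), <- E. reflexivity.
Qed.

Lemma ecf_tail_equiv m x : irrational x -> 1 < x -> Theta_equiv x (ecf_tail m x).
Proof.
  intros Hx H1. destruct (ecf_digits_gt_1 x Hx H1) as [Hd _].
  destruct (orbit_matrix_irrational _ m 1 Hd (or_introl eq_refl)) as (M & HM & _ & A).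
  exists M. split; [exact HM|]. split; [apply (act_irrational M x Hx)|].
  specialize (A x Hx). rewrite !Rmult_1_l in A. rewrite ecf_tail_eq by assumption.
  symmetry. exact A.
Qed.

(** One map on all irrationals, of either sign, whose iterates are the signed
    tails of an expansion. *)
Definition theta_map (x : R) : R := - / (x - IZR (near_even x)).

Lemma theta_map_irrational x : irrational x -> irrational (theta_map x).
Proof.
  intros H. pose proof (irrational_step x (-1) (near_even x) ltac:(lia) H) as K.
  unfold theta_map. replace (- / _) with (-1 / (x - IZR (near_even x))); [exact K|].
  pose proof (irrational_not_IZR _ (near_even x) H). field. lra.
Qed.

Lemma near_even_eq x a : irrational x -> Z.Even a -> -1 <= x - IZR a <= 1 -> near_even x = a.
Proof.
  intros Hx Ha H. symmetry. apply (even_integer_unique x); auto using near_even_bound, Even_near_even.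
Qed.

Lemma ecf_tail_iter m x : irrational x -> 1 < x -> ecf_tail m x = Nat.iter m theta_map x.
Proof.
  intros Hx H1. destruct (ecf_digits_gt_1 x Hx H1) as [Hd E].
  assert (I : forall k, irrational (Nat.iter k theta_map x)).
  { induction k; [exact Hx | apply theta_map_irrational, IHk]. }
  induction m.
  - rewrite ecf_tail_eq by assumption. unfold sign_prod. simpl. ring.
  - specialize (I m).
    change (Nat.iter (S m) theta_map x) with (theta_map (Nat.iter m theta_map x)). rewrite <- IHm in I |- *. clear IHm.
    rewrite ecf_tail_eq in I by assumption. rewrite !ecf_tail_eq by assumption.
    rewrite prefix_sign_S. cbn [digit_orbit].
    set (d := ecf_digits x) in *.
    assert (Is : irrational (ecf_int (skip m d))).
    { apply ecf_int_irrational_skip; [exact Hd|]. rewrite <- E. exact Hx. }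
    assert (Ex : digit_orbit d x m = ecf_int (skip m d)) by (rewrite E; apply digit_orbit_ecf, Hd).
    rewrite Ex in *.
    pose proof (ecf_first_digit (skip m d) (skip_admissible m d Hd) Is) as [B _].
    replace (skip m d 0%nat) with (d m) in B by (unfold skip; rewrite Nat.add_0_r; reflexivity).
    set (z := ecf_int (skip m d)) in *.
    pose proof (irrational_not_IZR z (fst (d m)) Is) as N.
    set (s := sign_prod (prefix m d)) in *.
    assert (Hs : s = 1%Z \/ s = (-1)%Z) by apply sign_prod_unit, prefix_admissible, Hd.
    unfold theta_map. rewrite (near_even_eq _ (s * fst (d m))); [|exact I| |].
    + rewrite !mult_IZR, opp_IZR.
      destruct (admissible_IZR _ (Hd m)) as [_ [-> | ->]];
      destruct (sign_cases s Hs) as [-> | ->]; field; lra.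
    + destruct (Hd m) as (_ & [k Hk] & _). exists (s * k)%Z. rewrite Hk. ring.
    + rewrite mult_IZR. destruct (sign_cases s Hs) as [-> | ->]; lra.
Qed.

(** Equality of tails, extended to all irrationals so that one can argue
    generator by generator. *)
Definition tail_equiv (x y : R) : Prop :=
  exists r s : nat, Nat.iter r theta_map x = Nat.iter s theta_map y.

Lemma tail_equiv_sym x y : tail_equiv x y -> tail_equiv y x.
Proof. intros (r & s & E). exists s, r. auto. Qed.

Lemma tail_equiv_trans x y z : tail_equiv x y -> tail_equiv y z -> tail_equiv x z.
Proof.
  intros (r & s & E) (p & q & F). exists (p + r)%nat, (s + q)%nat.
  rewrite !Nat.iter_add, E, <- F, <- !Nat.iter_add, Nat.add_comm. reflexivity.
Qed.

Lemma tail_equiv_shift x k : irrational x -> tail_equiv x (x + IZR (2 * k)).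
Proof.
  intros H. exists 1%nat, 1%nat. change (theta_map x = theta_map (x + IZR (2 * k))). unfold theta_map.
  rewrite (near_even_eq (x + IZR (2 * k)) (near_even x + 2 * k)).
  - rewrite plus_IZR. f_equal. f_equal. ring.
  - intros (p & q & Hq & E). apply H. exists (p - 2 * k * q)%Z, q. split; [exact Hq|].
    rewrite minus_IZR, mult_IZR. apply eq_IZR_contrapositive in Hq.
    apply (Rplus_eq_reg_r (IZR (2 * k))). rewrite E. field. exact Hq.
  - destruct (Even_near_even x) as [m ->]. exists (m + k)%Z. ring.
  - rewrite plus_IZR. pose proof (near_even_bound x H). lra.
Qed.

(** If [|x| <= 1] the nearest even integer is zero and [theta_map x] is [-1/x];
    otherwise the roles of [x] and [-1/x] are exchanged. *)
Lemma tail_equiv_opp_inv x : irrational x -> tail_equiv x (- / x).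
Proof.
  assert (K : forall x, irrational x -> -1 <= x <= 1 -> tail_equiv x (- / x)).
  { intros z Hz B. exists 1%nat, 0%nat. simpl. unfold theta_map.
    rewrite (near_even_eq z 0); [rewrite Rminus_0_r; reflexivity | exact Hz | exists 0%Z; reflexivity | simpl; lra]. }
  intros H. destruct (Rle_dec (Rabs x) 1) as [B|B].
  { apply K; [exact H|]. apply Rabs_le_between, B. }
  assert (N : x <> 0) by (apply (irrational_not_IZR x 0 H)).
  assert (I : irrational (- / x)).
  { pose proof (irrational_step x (-1) 0 ltac:(lia) H) as I.
    replace (- / x) with (-1 / (x - 0)); [exact I | field; lra]. }
  apply tail_equiv_sym. replace x with (- / (- / x)) at 2 by (field; lra).
  apply K; [exact I|].
  apply Rabs_le_between. rewrite Rabs_Ropp, Rabs_inv, <- Rinv_1.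
  apply Rinv_le_contravar; lra.
Qed.

(** Descent on [|c|].  A translation by an even number brings [a] into
    [[-|c|, |c|]]; the entries [a] and [c] of an element of Theta have opposite
    parities, so [|a| < |c|] then, and the inversion [z |-> -1/z] makes it the
    new lower left entry.  The case [c = 0] is an even translation. *)
Lemma theta_tail_equiv (m : nat) : forall (a b c d : Z), (Z.abs c <= Z.of_nat m)%Z ->
  (a * d - b * c = 1)%Z -> theta_entries a b c d ->
  forall x, irrational x -> tail_equiv x ((IZR a * x + IZR b) / (IZR c * x + IZR d)).
Proof.
  induction m; intros a b c d Hc Hdet Hpar x Hx.
  - assert (c = 0)%Z by lia. subst c.
    assert (Hb : Z.Even b).
    { apply Z.even_spec. rewrite <- Z.negb_odd.
      destruct Hpar as [P|P]; injection P; intros; [|discriminate].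
      replace (Z.odd b) with false. reflexivity. }
    destruct Hb as [k ->].
    assert (Ha : (a * d = 1)%Z) by lia.
    assert (a = 1 \/ a = -1)%Z as [-> | ->] by (apply Z.mul_eq_1 in Ha; lia).
    + assert (d = 1)%Z as -> by lia.
      replace ((1 * x + IZR (2 * k)) / (0 * x + 1)) with (x + IZR (2 * k)) by field.
      apply tail_equiv_shift, Hx.
    + assert (d = -1)%Z as -> by lia.
      replace ((-1 * x + IZR (2 * k)) / (0 * x + -1)) with (x + IZR (2 * - k)).
      * apply tail_equiv_shift, Hx.
      * rewrite !mult_IZR, opp_IZR. field.
  - destruct (Z_le_gt_dec (Z.abs c) (Z.of_nat m)) as [Hle|Hgt]; [eapply IHm; eauto|].
    assert (Hc0 : c <> 0%Z) by lia.
    destruct (irrational_moebius x a b c d Hx) as [D Iy]; [rewrite Hdet; lia|].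
    set (y := (IZR a * x + IZR b) / (IZR c * x + IZR d)) in *.
    (* translate so that the upper left entry is smaller than c, then invert *)
    assert (exists k, (Z.abs (a + 2 * k * c) <= Z.abs c)%Z) as [k Hk].
    { exists (- Z.sgn c * ((a + Z.abs c) / (2 * Z.abs c)))%Z.
      pose proof (Z.mod_pos_bound (a + Z.abs c) (2 * Z.abs c) ltac:(lia)) as B.
      pose proof (Z.div_mod (a + Z.abs c) (2 * Z.abs c) ltac:(lia)) as E.
      set (q := ((a + Z.abs c) / (2 * Z.abs c))%Z) in *.
      replace (a + 2 * (- Z.sgn c * q) * c)%Z with (a - 2 * Z.abs c * q)%Z.
      - lia.
      - assert (Z.abs c = c * Z.sgn c)%Z as -> by (destruct c; simpl; lia). ring. }
    set (a' := (a + 2 * k * c)%Z) in *. set (b' := (b + 2 * k * d)%Z).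
    assert (Hpar' : theta_entries (- c) (- d) a' b').
    { unfold a', b', theta_entries in *.
      rewrite !Z.odd_opp, !Z.odd_add, !Z.odd_mul. simpl.
      destruct (Z.odd a), (Z.odd b), (Z.odd c), (Z.odd d), Hpar as [P|P];
        try discriminate P; auto. }
    assert (Hlt : (Z.abs a' < Z.abs c)%Z).
    { assert (Z.odd a' <> Z.odd c).
      { unfold theta_entries in Hpar'. rewrite !Z.odd_opp in Hpar'.
        destruct (Z.odd a'), (Z.odd c), Hpar' as [P|P]; try discriminate P; discriminate. }
      assert (a' <> c) by (intros E; rewrite E in H; auto).
      assert (a' <> - c)%Z by (intros E; rewrite E, Z.odd_opp in H; auto).
      lia. }
    assert (Ey : (IZR (- c) * x + IZR (- d)) / (IZR a' * x + IZR b') = - / (y + IZR (2 * k))).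
    { assert (IZR a' * x + IZR b' <> 0).
      { apply (irrational_moebius x (-c) (-d) a' b' Hx). unfold a', b'.
        replace (_ - _)%Z with (a * d - b * c)%Z by ring. lia. }
      assert (E : IZR a' * x + IZR b' =
        IZR a * x + IZR b + IZR (2 * k) * (IZR c * x + IZR d)).
      { unfold a', b'. rewrite !plus_IZR, !mult_IZR. ring. }
      rewrite E in *. unfold y. rewrite !opp_IZR. field. split; [exact D|].
      intros Z. apply H. rewrite <- Z. ring. }
    assert (Iyk : irrational (y + IZR (2 * k))).
    { destruct (irrational_moebius y 1 (2 * k) 0 1 Iy) as [_ K]; [lia|].
      replace (y + IZR (2 * k)) with ((1 * y + IZR (2 * k)) / (0 * y + 1)) by field. exact K. }
    apply tail_equiv_trans with (- / (y + IZR (2 * k))).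
    + rewrite <- Ey. apply IHm; auto; [lia|].
      unfold a', b'. rewrite <- Hdet. ring.
    + apply tail_equiv_sym. apply tail_equiv_trans with (y + IZR (2 * k)).
      * apply tail_equiv_shift, Iy.
      * apply tail_equiv_opp_inv, Iyk.
Qed.

Lemma Theta_equiv_iff_tails x y : irrational x -> irrational y -> 1 < x -> 1 < y ->
  Theta_equiv x y <-> exists r s : nat, ecf_tail r x = ecf_tail s y.
Proof.
  intros Ix Iy Hx Hy. split.
  - intros (M & HM & _ & ->). apply Theta_entries in HM.
    destruct (theta_tail_equiv (Z.abs_nat (mc M)) _ _ _ (md M)
      ltac:(rewrite Zabs2Nat.id_abs; apply Z.le_refl) (mdet M) HM x Ix) as (r & s & E).
    exists r, s. rewrite !ecf_tail_iter by assumption. exact E.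
  - intros (r & s & E). apply Theta_equiv_trans with (ecf_tail r x).
    + apply ecf_tail_equiv; assumption.
    + rewrite E. apply Theta_equiv_sym, ecf_tail_equiv; assumption.
Qed.

(** * Periodic expansions and quadratic surds *)

Lemma quadratic_surd_of_poly x (A B C : Z) : irrational x ->
  ~ (A = 0 /\ B = 0 /\ C = 0)%Z -> is_root A B C x -> quadratic_surd x.
Proof.
  intros Hx N H. split; [exact Hx|]. exists A, B, C. split; [|exact H].
  intros ->. apply N. split; [reflexivity|]. apply (irrational_lin x); [exact Hx|].
  unfold is_root in H. lra.
Qed.

(** The transformed equation cannot vanish identically, because substituting
    back recovers [A (a d - b c)^2]; that its leading coefficient is nonzero then
    follows from irrationality. *)
Lemma quadratic_surd_moebius x (a b c d : Z) : (a * d - b * c <> 0)%Z -> quadratic_surd x ->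
  quadratic_surd ((IZR a * x + IZR b) / (IZR c * x + IZR d)).
Proof.
  intros Hdet [Hx (A & B & C & HA & Rx)].
  destruct (irrational_moebius x a b c d Hx Hdet) as [D Iw].
  apply (quadratic_surd_of_poly _ (A * d * d - B * c * d + C * c * c)
    (- 2 * A * b * d + B * (a * d + b * c) - 2 * C * a * c)
    (A * b * b - B * a * b + C * a * a)); [exact Iw| |].
  - intros (E1 & E2 & E3).
    assert (E : (A * ((a * d - b * c) * (a * d - b * c)) = 0)%Z).
    { transitivity (a * a * (A * d * d - B * c * d + C * c * c)
        + a * c * (- 2 * A * b * d + B * (a * d + b * c) - 2 * C * a * c)
        + c * c * (A * b * b - B * a * b + C * a * a))%Z; [ring|].
      rewrite E1, E2, E3. ring. }
    apply Z.mul_eq_0 in E. destruct E as [E|E]; [auto|].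
    apply Z.mul_eq_0 in E. tauto.
  - unfold is_root in *.
    repeat rewrite ?plus_IZR, ?minus_IZR, ?mult_IZR.
    transitivity ((IZR a * IZR d - IZR b * IZR c) ^ 2 * (IZR A * x ^ 2 + IZR B * x + IZR C)
      / (IZR c * x + IZR d) ^ 2); [field; exact D|].
    rewrite Rx. unfold Rdiv. ring.
Qed.

Lemma quadratic_surd_inv x : quadratic_surd x -> quadratic_surd (/ x).
Proof.
  intros H. pose proof (quadratic_surd_moebius x 0 1 1 0 ltac:(lia) H) as K.
  replace (/ x) with ((0 * x + 1) / (1 * x + 0)); [exact K|].
  field. apply (irrational_not_IZR x 0), H.
Qed.

Lemma quadratic_surd_unstep d : (forall n, admissible (d n)) ->
  quadratic_surd (ecf_int (skip 1 d)) -> quadratic_surd (ecf_int d).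
Proof.
  intros Hd H. rewrite (ecf_int_step d Hd).
  assert (Hdet : (fst (d 0%nat) * 0 - snd (d 0%nat) * 1 <> 0)%Z)
    by (destruct (Hd 0%nat) as (_ & _ & [-> | ->]); lia).
  pose proof (quadratic_surd_moebius _ _ _ _ _ Hdet H) as K.
  replace (_ + _) with ((IZR (fst (d 0%nat)) * ecf_int (skip 1 d) + IZR (snd (d 0%nat)))
    / (1 * ecf_int (skip 1 d) + 0)); [exact K|].
  field. pose proof (ecf_int_ge_1 _ (skip_admissible 1 d Hd)). lra.
Qed.

Lemma digit_orbit_bounded d y n : (forall k, admissible (d k)) -> -1 <= y <= 1 ->
  -1 <= digit_orbit d y n <= 1.
Proof.
  intros Hd Hy. induction n; [exact Hy|]. cbn [digit_orbit].
  set (w := digit_orbit d y n) in *.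
  pose proof (branch_bounded (d n) (- w) (Hd n) ltac:(lra)) as B. unfold branch in B.
  destruct (admissible_IZR _ (Hd n)) as [Ha _].
  replace (_ / _) with (- (IZR (snd (d n)) / (IZR (fst (d n)) + - w))) by (field; lra).
  lra.
Qed.

(** Both [x] and minus the reversed expansion return after one period, so the
    matrix of the period fixes them.  The statement carries a sign [e] because
    the forward endpoint of a geodesic may be negative. *)
Lemma periodic_matrix l e : is_block l -> 1 < ecf_int (cycle l) -> sign_prod l = 1%Z ->
  e = 1%Z \/ e = (-1)%Z ->
  exists M, Theta M /\ mb M <> 0%Z /\
    forall z, z = ecf_int (cycle l) \/ z = - ext_ecf (cycle (rev l)) ->
      denom M (IZR e * z) <> 0 /\ act M (IZR e * z) = IZR e * z.
Proof.
  intros Hl H1 Hs He. pose proof (cycle_admissible l Hl) as Hd.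
  destruct (orbit_matrix (cycle l) (length l) e Hd He) as (M & HM & Hb & A).
  exists M. split; [exact HM|]. split.
  { apply Hb. destruct Hl as [Hl _]. destruct l; [contradiction|simpl; lia]. }
  rewrite cycle_prefix, Hs in A.
  pose proof (cycle_irrational l Hl H1) as Ix.
  intros z Hz.
  assert (digit_orbit (cycle l) z (length l) = z /\
    forall k, digit_orbit (cycle l) z k <> IZR (fst (cycle l k))) as [Ez Nz].
  { destruct Hz as [-> | ->].
    - split; [rewrite digit_orbit_ecf, cycle_period by (exact Hd || apply Hl); reflexivity|].
      intros k. rewrite digit_orbit_ecf by exact Hd.
      apply irrational_not_IZR, ecf_int_irrational_skip; assumption.
    - split; [apply digit_orbit_ext_rev, Hl|]. intros k.
      pose proof (ext_ecf_bounded _ (cycle_admissible _ (rev_block l Hl))) as B.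
      pose proof (digit_orbit_bounded _ (- ext_ecf (cycle (rev l))) k Hd ltac:(lra)).
      destruct (admissible_IZR _ (Hd k)). lra. }
  destruct (A z (fun k _ => Nz k)) as [D E]. split; [exact D|].
  rewrite E, Ez. ring.
Qed.

(** Fixed points of [M] are the roots of [c z^2 + (d - a) z - b]. *)
Lemma fixed_points_conjugate M x y : mb M <> 0%Z -> irrational x ->
  denom M y <> 0 -> act M x = x -> act M y = y -> y <> x ->
  mc M <> 0%Z /\ is_conjugate x y.
Proof.
  intros Hb Hx Dy Ex Ey N.
  assert (K : forall z, denom M z <> 0 -> act M z = z ->
    is_root (mc M) (md M - ma M) (- mb M) z).
  { intros z Dz Ez. unfold is_root. rewrite minus_IZR, opp_IZR.
    apply (f_equal (fun t => t * denom M z)) in Ez.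
    unfold act in Ez. fold (denom M z) in Ez. unfold Rdiv in Ez.
    rewrite Rmult_assoc, Rinv_l, Rmult_1_r in Ez by exact Dz. unfold denom in Ez. lra. }
  pose proof (K x (proj1 (act_irrational M x Hx)) Ex) as Kx.
  assert (C : mc M <> 0%Z).
  { intros E. apply Hb. assert (- mb M = 0)%Z; [|lia].
    apply (irrational_lin x (md M - ma M)); [exact Hx|].
    unfold is_root in Kx. rewrite E in Kx. lra. }
  split; [exact C|]. exists (mc M), (md M - ma M)%Z, (- mb M)%Z. auto.
Qed.

Lemma is_conjugate_irrational x y : irrational x -> is_conjugate x y -> irrational y.
Proof.
  intros Hx (A & B & C & HA & Rx & Ry & N).
  apply (surd_pair_irrational (B * B - 4 * A * C) (A, B, C) x); [exact Hx|].
  repeat split; assumption.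
Qed.

(** The value of the reversed period is in [[-1, 1]] and [x > 1], so the two
    fixed points are different; the ends of the interval are excluded because a
    conjugate of an irrational is irrational. *)
Lemma periodic_conjugate l : is_block l -> 1 < ecf_int (cycle l) ->
  is_conjugate (ecf_int (cycle l)) (- ext_ecf (cycle (rev l))) /\
  -1 < - ext_ecf (cycle (rev l)) < 1.
Proof.
  intros Hl H1. destruct (positive_block l Hl) as (l' & Hl' & Hs & Ec & Er).
  rewrite <- Ec, <- Er in *. clear l Hl Ec Er.
  pose proof (cycle_irrational l' Hl' H1) as Ix.
  pose proof (ext_ecf_bounded _ (cycle_admissible _ (rev_block l' Hl'))) as B.
  destruct (periodic_matrix l' 1 Hl' H1 Hs (or_introl eq_refl)) as (M & _ & Hb & F).
  destruct (F _ (or_introl eq_refl)) as [_ Fx]. destruct (F _ (or_intror eq_refl)) as [Dy Fy].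
  rewrite Rmult_1_l in *.
  assert (C : is_conjugate (ecf_int (cycle l')) (- ext_ecf (cycle (rev l')))).
  { apply (fixed_points_conjugate M); auto. lra. }
  split; [exact C|].
  pose proof (is_conjugate_irrational _ _ Ix C) as Iy.
  pose proof (irrational_not_IZR _ 1 Iy). pose proof (irrational_not_IZR _ (-1) Iy). lra.
Qed.

Lemma is_conjugate_surd x y : irrational x -> is_conjugate x y -> quadratic_surd x.
Proof. intros Hx (A & B & C & HA & Rx & _). split; [exact Hx|]. exists A, B, C. auto. Qed.

Lemma purely_periodic_iff alpha : 1 < alpha ->
  has_purely_periodic_ecf alpha <-> quadratic_surd alpha /\ -1 < surd_conj alpha < 1.
Proof.
  intros H1. split.
  - intros (l & Hl & Hd & [[? ?]|[_ E]]); [lra|]. subst alpha.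
    destruct (periodic_conjugate l Hl H1) as [C B].
    pose proof (cycle_irrational l Hl H1) as Ix.
    rewrite (surd_conj_eq _ _ Ix C). split; [|exact B]. eapply is_conjugate_surd; eauto.
  - intros [S B]. destruct (ecf_int_exists alpha (proj1 S) H1) as (d & Hd & E).
    destruct (quadratic_surd_pair alpha S) as (D & F & P). apply surd_pair_conjugate in P.
    pose proof (proj1 S) as Ix. rewrite E in Ix, P at 1.
    destruct (reduced_purely_periodic d (surd_conj alpha) Hd Ix P B) as (p & Hp & Per).
    exists (prefix p d). split; [apply prefix_block; assumption|].
    rewrite <- periodic_cycle by assumption. split; auto.
Qed.

Lemma surd_conj_periodic alpha l : 1 < alpha -> is_block l -> alpha = ecf_int (cycle l) ->
  surd_conj alpha = - ext_ecf (cycle (rev l)).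
Proof.
  intros H1 Hl ->. apply surd_conj_eq; [apply cycle_irrational; assumption|].
  apply periodic_conjugate; assumption.
Qed.

Lemma surd_eventually_reduced d y : (forall n, admissible (d n)) -> irrational (ecf_int d) ->
  is_conjugate (ecf_int d) y ->
  exists n, -1 < digit_orbit d y n < 1 /\
    is_conjugate (ecf_int (skip n d)) (digit_orbit d y n).
Proof.
  intros Hd Hx C. pose proof (is_conjugate_irrational _ _ Hx C) as Iy.
  assert (N : y <> ecf_int d) by (destruct C as (? & ? & ? & ? & ? & ? & N); exact N).
  destruct (digit_orbit_eventually_reduced d y Hd Hx Iy N) as [n Hn].
  exists n. split; [exact Hn|].
  destruct C as (A & B & C & HA & Rx & Ry & _).
  assert (P : surd_pair (B * B - 4 * A * C) (A, B, C) (ecf_int d) y) by (repeat split; assumption).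
  destruct (surd_pair_orbit _ _ d _ _ n Hd Hx P) as (_ & _ & P').
  rewrite digit_orbit_ecf in P' by exact Hd. eapply surd_pair_conjugate; eauto.
Qed.

Lemma ecf_int_eventually_periodic d : (forall n, admissible (d n)) -> irrational (ecf_int d) ->
  eventually_periodic d <-> quadratic_surd (ecf_int d).
Proof.
  intros Hd Hx. split.
  - intros (N & l & Hl & E).
    assert (K : quadratic_surd (ecf_int (skip N d))).
    { assert (Ec : skip N d = cycle l) by (apply functional_extensionality; exact E).
      pose proof (ecf_int_irrational_skip d N Hd Hx) as I.
      pose proof (ecf_int_gt_1 _ (skip_admissible N d Hd) I) as G.
      rewrite Ec in *. apply (is_conjugate_surd _ _ I (proj1 (periodic_conjugate l Hl G))). }
    clear E. induction N; [exact K|]. apply IHN. apply quadratic_surd_unstep.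
    + apply skip_admissible, Hd.
    + rewrite skip_skip, Nat.add_1_r. exact K.
  - intros S. destruct (quadratic_surd_pair _ S) as (D & F & P). apply surd_pair_conjugate in P.
    destruct (surd_eventually_reduced d _ Hd Hx P) as (n & Hn & C).
    destruct (reduced_purely_periodic (skip n d) _ (skip_admissible n d Hd)
      (ecf_int_irrational_skip d n Hd Hx) C Hn) as (p & Hp & Per).
    exists n, (prefix p (skip n d)). split; [apply prefix_block; auto using skip_admissible|].
    intros k. rewrite <- periodic_cycle by assumption. reflexivity.
Qed.

Lemma eventually_periodic_iff alpha : irrational alpha -> 0 < alpha ->
  eventually_periodic (ecf_digits alpha) <-> quadratic_surd alpha.
Proof.
  intros Hx H0. destruct (ecf_digits_spec alpha Hx H0) as [Hd [[_ E]|[_ E]]].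
  - rewrite ecf_frac_inv in E by exact Hd.
    pose proof (f_equal Rinv E) as Ei. rewrite Rinv_inv in Ei. symmetry in Ei.
    rewrite ecf_int_eventually_periodic; [|exact Hd | rewrite Ei; apply irrational_inv, Hx].
    rewrite Ei. split; intros S; [rewrite <- Rinv_inv|]; apply quadratic_surd_inv, S.
  - rewrite E at 2. apply ecf_int_eventually_periodic; [exact Hd|]. rewrite <- E. exact Hx.
Qed.

(** * Geodesics as hyperbolas on the hyperboloid *)

(** Vectors [(p, q, r)], standing for the symmetric matrices with entries [r],
    [q], [q], [p], on which a matrix [M] acts by [X |-> M X M^T]. *)
Record vec : Type := mkvec { vp : R; vq : R; vr : R }.

Lemma vec_eq v w : vp v = vp w -> vq v = vq w -> vr v = vr w -> v = w.
Proof. destruct v, w. simpl. intros -> -> ->. reflexivity. Qed.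

Definition lin (a : R) (v : vec) (b : R) (w : vec) : vec :=
  mkvec (a * vp v + b * vp w) (a * vq v + b * vq w) (a * vr v + b * vr w).

(** The polarization of twice the determinant [p r - q^2], of Lorentzian
    signature. *)
Definition pairing (v w : vec) : R := vp v * vr w + vr v * vp w - 2 * (vq v * vq w).

Definition rho (M : SL2Z) (v : vec) : vec :=
  let a := IZR (ma M) in let b := IZR (mb M) in
  let c := IZR (mc M) in let d := IZR (md M) in
  mkvec (c * c * vr v + 2 * c * d * vq v + d * d * vp v)
        (a * c * vr v + (a * d + b * c) * vq v + b * d * vp v)
        (a * a * vr v + 2 * a * b * vq v + b * b * vp v).

(** The point of the hyperboloid [p r - q^2 = 1] that corresponds to a point of
    the half-plane.  Its pairings are [2 cosh] of the hyperbolic distance. *)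
Definition coords (z : C) : vec :=
  mkvec (/ Im z) (Re z / Im z) ((Re z ^ 2 + Im z ^ 2) / Im z).

Lemma rho_lin M a v b w : rho M (lin a v b w) = lin a (rho M v) b (rho M w).
Proof. unfold rho, lin. simpl. f_equal; ring. Qed.

Lemma pairing_rho M v w : pairing (rho M v) (rho M w) = pairing v w.
Proof.
  transitivity ((IZR (ma M) * IZR (md M) - IZR (mb M) * IZR (mc M)) ^ 2 * pairing v w).
  - unfold pairing, rho. simpl. ring.
  - rewrite mdet_R. ring.
Qed.

Lemma coords_inj z w : 0 < Im z -> 0 < Im w -> coords z = coords w -> z = w.
Proof.
  destruct z as [x y], w as [x' y']. unfold coords, Re, Im. simpl. intros Hy Hy' E.
  injection E as E1 E2 _.
  apply (f_equal Rinv) in E1. rewrite !Rinv_inv in E1. subst y'.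
  f_equal. unfold Rdiv in E2. apply Rmult_eq_reg_r in E2; [exact E2|].
  apply Rinv_neq_0_compat. lra.
Qed.

Lemma pairing_coords z : 0 < Im z -> pairing (coords z) (coords z) = 2.
Proof. intros H. unfold pairing, coords. simpl. field. lra. Qed.

Lemma moebius_coords M z : 0 < Im z ->
  0 < Im (moebius M z) /\ coords (moebius M z) = rho M (coords z).
Proof.
  destruct z as [u v]. intros Hv. change (0 < v) in Hv.
  pose proof (mdet_R M) as Hdet.
  set (a := IZR (ma M)) in *. set (b := IZR (mb M)) in *.
  set (c := IZR (mc M)) in *. set (d := IZR (md M)) in *.
  set (D := (c * u + d) ^ 2 + (c * v) ^ 2).
  assert (HD : 0 < D).
  { unfold D. destruct (Req_dec c 0) as [E|E].
    - rewrite E in *. assert (d <> 0) by (intros E'; rewrite E' in Hdet; lra).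
      pose proof (pow2_gt_0 d H). nra.
    - pose proof (pow2_gt_0 (c * v) ltac:(apply Rmult_integral_contrapositive; split; lra)).
      pose proof (pow2_ge_0 (c * u + d)). lra. }
  assert (E : moebius M (u, v) = (((a * u + b) * (c * u + d) + a * c * v ^ 2) / D, v / D)).
  { unfold moebius, Cdiv, Cmult, Cinv, Cplus, RtoC. simpl. fold a b c d.
    assert (HD' : (c * u - 0 * v + d) ^ 2 + (c * v + 0 * u + 0) ^ 2 = D) by (unfold D; ring).
    simpl in HD'.
    apply injective_projections; simpl.
    - rewrite HD'. unfold Rdiv. ring.
    - rewrite HD'. transitivity ((a * d - b * c) * v / D); [unfold Rdiv; ring|].
      rewrite Hdet. unfold Rdiv. ring. }
  rewrite E. unfold coords, rho, Re, Im. cbn [fst snd vp vq vr]. fold a b c d.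
  split; [apply Rdiv_lt_0_compat; assumption|].
  f_equal.
  - unfold D. field. fold D. split; lra.
  - field. split; lra.
  - transitivity ((((a * u + b) * (c * u + d) + a * c * v ^ 2) ^ 2 + ((a * d - b * c) * v) ^ 2) / D / v).
    + rewrite Hdet. field. split; lra.
    + transitivity (((a * u + b) ^ 2 + (a * v) ^ 2) * D / D / v).
      * unfold D. f_equal. f_equal. ring.
      * field. split; lra.
Qed.

Lemma Cmod_sq z w : Cmod (z - w)%C * Cmod (z - w)%C = (Re z - Re w) ^ 2 + (Im z - Im w) ^ 2.
Proof.
  unfold Cmod. rewrite sqrt_sqrt.
  - destruct z, w. unfold Re, Im. simpl. ring.
  - pose proof (pow2_ge_0 (fst (z - w)%C)). pose proof (pow2_ge_0 (snd (z - w)%C)). lra.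
Qed.

(** Consequently the distance depends only on the pairing, which makes the
    invariance under Moebius maps a matter of linear algebra. *)
Lemma hyp_dist_pairing z w : 0 < Im z -> 0 < Im w ->
  hyp_dist z w = 2 * arcsinh (sqrt ((pairing (coords z) (coords w) - 2) / 4)).
Proof.
  intros Hz Hw. unfold hyp_dist. f_equal. f_equal. symmetry.
  set (m := Cmod (z - w)%C). set (s := sqrt (Im z * Im w)).
  assert (Hs : 0 < s) by (apply sqrt_lt_R0, Rmult_lt_0_compat; assumption).
  assert (Hss : s * s = Im z * Im w) by (apply sqrt_sqrt; nra).
  assert (Hm : m * m = (Re z - Re w) ^ 2 + (Im z - Im w) ^ 2) by apply Cmod_sq.
  assert (E : m / (2 * s) * (m / (2 * s)) = (pairing (coords z) (coords w) - 2) / 4).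
  { replace (m / (2 * s) * (m / (2 * s))) with ((m * m) / (4 * (s * s))) by (field; lra).
    rewrite Hm, Hss. unfold pairing, coords. simpl. field. lra. }
  assert (0 <= m / (2 * s)).
  { apply Rmult_le_pos; [apply Cmod_ge_0 | apply Rlt_le, Rinv_0_lt_compat; lra]. }
  apply sqrt_lem_1; [rewrite <- E; nra | assumption | exact E].
Qed.

Lemma hyp_dist_moebius M z w : 0 < Im z -> 0 < Im w ->
  hyp_dist (moebius M z) (moebius M w) = hyp_dist z w.
Proof.
  intros Hz Hw. destruct (moebius_coords M z Hz) as [Pz Ez], (moebius_coords M w Hw) as [Pw Ew].
  rewrite !hyp_dist_pairing, Ez, Ew, pairing_rho by assumption. reflexivity.
Qed.

Lemma geodesic_moebius M g : geodesic g -> geodesic (fun t => moebius M (g t)).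
Proof.
  intros [Hp Hd]. split; [intros t; apply moebius_coords, Hp|].
  intros s t. rewrite hyp_dist_moebius; auto.
Qed.

(** From [sinh^2 (d / 2) = (pairing - 2) / 4] and the half-angle formula. *)
Lemma geodesic_pairing g s t : geodesic g ->
  pairing (coords (g s)) (coords (g t)) = exp (s - t) + exp (t - s).
Proof.
  intros [Hp Hd]. specialize (Hd s t). pose proof (Hp s) as Ps. pose proof (Hp t) as Pt.
  rewrite hyp_dist_pairing in Hd by assumption.
  set (F := pairing (coords (g s)) (coords (g t))) in *.
  assert (HF : 0 <= (F - 2) / 4).
  { unfold F, pairing, coords. simpl.
    assert (0 < Im (g s) * Im (g t)) by nra.
    replace (_ / 4) with (((Re (g s) - Re (g t)) ^ 2 + (Im (g s) - Im (g t)) ^ 2) / (4 * (Im (g s) * Im (g t))))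
      by (field; lra).
    apply Rmult_le_pos; [|apply Rlt_le, Rinv_0_lt_compat; lra].
    pose proof (pow2_ge_0 (Re (g s) - Re (g t))). pose proof (pow2_ge_0 (Im (g s) - Im (g t))). lra. }
  assert (E : sqrt ((F - 2) / 4) = sinh (Rabs (s - t) / 2)).
  { rewrite <- Hd. rewrite <- (sinh_arcsinh (sqrt ((F - 2) / 4))) at 1. f_equal. field. }
  assert (E2 : (F - 2) / 4 = sinh (Rabs (s - t) / 2) ^ 2).
  { rewrite <- E. rewrite <- (sqrt_sqrt _ HF) at 1. ring. }
  assert (E3 : sinh (Rabs (s - t) / 2) ^ 2 = (exp (s - t) + exp (t - s) - 2) / 4).
  { unfold sinh. set (h := Rabs (s - t) / 2).
    assert (K : exp h * exp (- h) = 1) by (rewrite <- exp_plus, Rplus_opp_r; apply exp_0).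
    transitivity ((exp (h + h) + exp (- h + - h) - 2) / 4).
    - transitivity ((exp h * exp h + exp (- h) * exp (- h) - 2 * (exp h * exp (- h))) / 4); [field|].
      rewrite K, !exp_plus. field.
    - f_equal. f_equal. unfold h, Rabs. destruct Rcase_abs.
      + rewrite Rplus_comm. f_equal; f_equal; field.
      + f_equal; f_equal; field. }
  lra.
Qed.

(** The orthogonal complement of a timelike vector is negative definite, so it
    contains no nonzero null vector. *)
Lemma null_orthogonal_zero p q r p0 q0 r0 : p * r = q * q -> p0 * r0 - q0 * q0 = 1 ->
  p * r0 + r * p0 = 2 * (q * q0) -> p = 0 /\ q = 0 /\ r = 0.
Proof.
  intros H H0 K.
  assert (S : (p * r0 - r * p0) ^ 2 + 4 * (q * q) = 0).
  { replace ((p * r0 - r * p0) ^ 2) with ((p * r0 + r * p0) ^ 2 - 4 * (p * r) * (p0 * r0)) by ring.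
    rewrite K, H. replace (p0 * r0) with (1 + q0 * q0) by lra. ring. }
  pose proof (pow2_ge_0 (p * r0 - r * p0)) as S1. pose proof (Rle_0_sqr q) as S2.
  unfold Rsqr in S2.
  assert (Hq : q = 0) by (apply Rsqr_0_uniq; unfold Rsqr; lra).
  assert (Hd : p * r0 - r * p0 = 0) by (apply Rsqr_0_uniq; rewrite Rsqr_pow2; lra).
  subst q.
  assert (Hp : p * r0 = 0) by lra. assert (Hr : r * p0 = 0) by lra.
  pose proof (Rle_0_sqr q0) as S0. unfold Rsqr in S0.
  assert (r0 <> 0) by (intros Z; rewrite Z in H0; lra).
  assert (p0 <> 0) by (intros Z; rewrite Z in H0; lra).
  apply Rmult_integral in Hp, Hr. tauto.
Qed.

(** A unit-speed geodesic in hyperboloid coordinates: the null vectors [A] and [B]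
    represent its forward and backward endpoints. *)
Definition on_line (g : R -> C) (A B : vec) : Prop :=
  pairing A A = 0 /\ pairing B B = 0 /\ pairing A B = 1 /\
  forall t, coords (g t) = lin (exp t) A (exp (- t)) B.

(** [A] and [B] are determined by the points at times [0] and [1].  For every
    [t], the pairings prescribed by the distances show that the difference [Z] of
    the two sides is null and orthogonal to the point at time [0], hence zero. *)
Lemma geodesic_line g : geodesic g -> exists A B, on_line g A B.
Proof.
  intros Hg. set (k := exp 1). set (k' := exp (-1)).
  set (X0 := coords (g 0)). set (X1 := coords (g 1)).
  assert (Hk : k * k' = 1) by (unfold k, k'; rewrite <- exp_plus, Rplus_opp_r; apply exp_0).
  assert (Hkk : k - k' <> 0).
  { assert (k' < k) by (apply exp_increasing; lra). lra. }
  assert (F00 : pairing X0 X0 = 2) by apply pairing_coords, Hg.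
  assert (F11 : pairing X1 X1 = 2) by apply pairing_coords, Hg.
  assert (F01 : pairing X0 X1 = k + k').
  { unfold X0, X1. rewrite geodesic_pairing by exact Hg. unfold k, k'. rewrite Rplus_comm.
    f_equal; f_equal; ring. }
  set (A := lin (/ (k - k')) X1 (- k' / (k - k')) X0).
  set (B := lin (k / (k - k')) X0 (- / (k - k')) X1).
  assert (FAA : pairing A A = 0).
  { transitivity ((pairing X1 X1 - 2 * k' * pairing X0 X1 + k' * k' * pairing X0 X0) / (k - k') ^ 2);
      [unfold A, pairing, lin; cbn [vp vq vr]; field; exact Hkk|].
    rewrite F00, F11, F01. replace (2 - _ + _) with (2 - 2 * (k * k')) by ring. rewrite Hk. field. exact Hkk. }
  assert (FBB : pairing B B = 0).
  { transitivity ((pairing X1 X1 - 2 * k * pairing X0 X1 + k * k * pairing X0 X0) / (k - k') ^ 2);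
      [unfold B, pairing, lin; cbn [vp vq vr]; field; exact Hkk|].
    rewrite F00, F11, F01. replace (2 - _ + _) with (2 - 2 * (k * k')) by ring. rewrite Hk. field. exact Hkk. }
  assert (FAB : pairing A B = 1).
  { transitivity (((k + k') * pairing X0 X1 - pairing X1 X1 - k * k' * pairing X0 X0) / (k - k') ^ 2);
      [unfold A, B, pairing, lin; cbn [vp vq vr]; field; exact Hkk|].
    rewrite F00, F11, F01, Hk.
    replace ((k + k') * (k + k') - 2 - 1 * 2) with ((k - k') ^ 2 + 4 * (k * k') - 4) by ring.
    rewrite Hk. field. exact Hkk. }
  exists A, B. split; [exact FAA|]. split; [exact FBB|]. split; [exact FAB|].
  intros t. set (X := coords (g t)). set (E := exp t). set (E' := exp (- t)).
  assert (HE : E * E' = 1) by (unfold E, E'; rewrite <- exp_plus, Rplus_opp_r; apply exp_0).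
  assert (FX : pairing X X = 2) by apply pairing_coords, Hg.
  assert (FX0 : pairing X X0 = E + E').
  { unfold X, X0. rewrite geodesic_pairing by exact Hg. unfold E, E'. f_equal; f_equal; ring. }
  assert (FX1 : pairing X X1 = E * k' + E' * k).
  { unfold X, X1. rewrite geodesic_pairing by exact Hg. unfold E, E', k, k'. rewrite <- !exp_plus.
    f_equal; f_equal; ring. }
  assert (FXA : pairing X A = E').
  { transitivity ((pairing X X1 - k' * pairing X X0) / (k - k'));
      [unfold A, pairing, lin; cbn [vp vq vr]; field; exact Hkk|].
    rewrite FX0, FX1. field. exact Hkk. }
  assert (FXB : pairing X B = E).
  { transitivity ((k * pairing X X0 - pairing X X1) / (k - k'));
      [unfold B, pairing, lin; cbn [vp vq vr]; field; exact Hkk|].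
    rewrite FX0, FX1. field. exact Hkk. }
  assert (FA0 : pairing A X0 = 1).
  { transitivity ((pairing X0 X1 - k' * pairing X0 X0) / (k - k'));
      [unfold A, pairing, lin; cbn [vp vq vr]; field; exact Hkk|].
    rewrite F00, F01. field. exact Hkk. }
  assert (FB0 : pairing B X0 = 1).
  { transitivity ((k * pairing X0 X0 - pairing X0 X1) / (k - k'));
      [unfold B, pairing, lin; cbn [vp vq vr]; field; exact Hkk|].
    rewrite F00, F01. field. exact Hkk. }
  (* the difference is null and orthogonal to the timelike vector X0 *)
  set (Z := lin 1 X (-1) (lin E A E' B)).
  assert (FZZ : pairing Z Z = 0).
  { transitivity (pairing X X - 2 * E * pairing X A - 2 * E' * pairing X B
      + E * E * pairing A A + 2 * (E * E') * pairing A B + E' * E' * pairing B B);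
      [unfold Z, pairing, lin; cbn [vp vq vr]; ring|].
    rewrite FX, FXA, FXB, FAA, FBB, FAB, HE.
    replace (2 * E * E') with (2 * (E * E')) by ring.
    replace (2 * E' * E) with (2 * (E * E')) by ring. rewrite HE. ring. }
  assert (FZ0 : pairing Z X0 = 0).
  { transitivity (pairing X X0 - E * pairing A X0 - E' * pairing B X0);
      [unfold Z, pairing, lin; cbn [vp vq vr]; ring|]. rewrite FX0, FA0, FB0. ring. }
  destruct (null_orthogonal_zero (vp Z) (vq Z) (vr Z) (vp X0) (vq X0) (vr X0)) as (Zp & Zq & Zr).
  - unfold pairing in FZZ. lra.
  - unfold pairing in F00. lra.
  - unfold pairing in FZ0. lra.
  - unfold Z, lin in Zp, Zq, Zr. simpl in Zp, Zq, Zr.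
    apply vec_eq; simpl; lra.
Qed.

Lemma on_line_moebius M g A B : geodesic g -> on_line g A B ->
  on_line (fun t => moebius M (g t)) (rho M A) (rho M B).
Proof.
  intros Hg (H1 & H2 & H3 & H). unfold on_line. rewrite !pairing_rho. repeat split; try assumption.
  intros t. rewrite (proj2 (moebius_coords M (g t) (proj1 Hg t))), H. apply rho_lin.
Qed.

Lemma on_line_reverse g A B : on_line g A B -> on_line (fun t => g (- t)) B A.
Proof.
  intros (H1 & H2 & H3 & H). repeat split; try assumption.
  - rewrite <- H3. unfold pairing. ring.
  - intros t. rewrite H, Ropp_involutive. unfold lin. f_equal; ring.
Qed.

Lemma exp_coef_nonneg a b : (forall t, 0 < a * exp t + b * exp (- t)) -> 0 <= a.
Proof.
  intros H. apply Rnot_lt_le. intros Ha.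
  set (s := 1 + Rabs b / - a). assert (Hs : 1 <= s).
  { unfold s. assert (0 <= Rabs b / - a); [|lra].
    apply Rmult_le_pos; [apply Rabs_pos | apply Rlt_le, Rinv_0_lt_compat; lra]. }
  specialize (H (ln s)). rewrite exp_Ropp, exp_ln in H by lra.
  assert (K : a * s = a - Rabs b) by (unfold s; field; lra).
  assert (I : 0 < / s <= 1).
  { split; [apply Rinv_0_lt_compat; lra|]. rewrite <- Rinv_1. apply Rinv_le_contravar; lra. }
  pose proof (Rle_abs b). pose proof (Rabs_pos b). nra.
Qed.

Lemma on_line_nonneg g A B : geodesic g -> on_line g A B -> 0 <= vp A.
Proof.
  intros Hg (_ & _ & _ & H). apply (exp_coef_nonneg _ (vp B)). intros t.
  pose proof (f_equal vp (H t)) as E. simpl in E.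
  pose proof (Rinv_0_lt_compat _ (proj1 Hg t)). lra.
Qed.

(** A null vector with [vp A <> 0] represents the real boundary point
    [vq A / vp A]; those with [vp A = 0] represent the point at infinity. *)
Lemma null_eq A : pairing A A = 0 -> vp A <> 0 ->
  A = mkvec (vp A) (vp A * (vq A / vp A)) (vp A * (vq A / vp A * (vq A / vp A))).
Proof.
  intros H N. unfold pairing in H. apply vec_eq; simpl; [reflexivity | field; exact N|].
  apply (Rmult_eq_reg_l (vp A)); [|exact N].
  transitivity (vq A * vq A); [lra | field; exact N].
Qed.

(** * Endpoints of geodesics *)

Lemma filterlim_C (g : R -> C) F (FF : Filter F) (z : C) :
  filterlim g F (locally z) <->
  filterlim (fun t => Re (g t)) F (locally (Re z)) /\
  filterlim (fun t => Im (g t)) F (locally (Im z)).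
Proof.
  rewrite !filterlim_locally. split.
  - intros H. split; intros eps; specialize (H eps); revert H; apply filter_imp;
      intros t [H1 H2]; assumption.
  - intros [H1 H2] eps. generalize (filter_and _ _ (H1 eps) (H2 eps)).
    apply filter_imp. intros t [K1 K2]. split; assumption.
Qed.

Lemma is_lim_exp_opp : is_lim (fun t => exp (- t)) p_infty 0.
Proof.
  apply (is_lim_comp exp Ropp p_infty 0 m_infty).
  - apply is_lim_exp_m.
  - apply (is_lim_opp (fun t => t) p_infty p_infty), is_lim_id.
  - exists 0. intros y _. discriminate.
Qed.

Lemma is_lim_div_finite (f h : R -> R) (x : Rbar) (a b : R) :
  is_lim f x a -> is_lim h x b -> b <> 0 -> is_lim (fun t => f t / h t) x (a / b).
Proof.
  intros Hf Hh N. apply (is_lim_div f h x a b Hf Hh).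
  - intros E. apply N. injection E. trivial.
  - exact I.
Qed.

(** As [t] grows, the term of [A] dominates: [Re] is the quotient of the second
    and first coordinates, and [Im] is the inverse of the first one. *)
Lemma on_line_forward g A B : geodesic g -> on_line g A B -> 0 < vp A ->
  forward_endpoint g (vq A / vp A).
Proof.
  intros Hg (_ & _ & _ & H) HA. pose proof is_lim_exp_opp as L.
  assert (L2 : is_lim (fun t => exp (- t) * exp (- t)) p_infty 0).
  { replace (Finite 0) with (Rbar_mult 0 0) by (simpl; f_equal; ring).
    apply is_lim_mult; [exact L | exact L | exact I]. }
  assert (Lp : is_lim (fun t => vp A + vp B * (exp (- t) * exp (- t))) p_infty (vp A)).
  { replace (Finite (vp A)) with (Finite (vp A + vp B * 0)) by (f_equal; ring).
    apply is_lim_plus'; [apply is_lim_const|].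
    apply (is_lim_scal_l _ (vp B) p_infty 0), L2. }
  assert (Lq : is_lim (fun t => vq A + vq B * (exp (- t) * exp (- t))) p_infty (vq A)).
  { replace (Finite (vq A)) with (Finite (vq A + vq B * 0)) by (f_equal; ring).
    apply is_lim_plus'; [apply is_lim_const|].
    apply (is_lim_scal_l _ (vq B) p_infty 0), L2. }
  assert (P : forall t, / Im (g t) = vp A * exp t + vp B * exp (- t) /\
                        Re (g t) / Im (g t) = vq A * exp t + vq B * exp (- t)).
  { intros t. pose proof (f_equal vp (H t)) as E1. pose proof (f_equal vq (H t)) as E2.
    simpl in E1, E2. lra. }
  assert (Q : forall t, exp t * exp (- t) = 1)
    by (intros t; rewrite <- exp_plus, Rplus_opp_r; apply exp_0).
  assert (K : forall t, vp A + vp B * (exp (- t) * exp (- t)) = exp (- t) * / Im (g t) /\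
                        vq A + vq B * (exp (- t) * exp (- t)) = exp (- t) * (Re (g t) / Im (g t))).
  { intros t. destruct (P t) as [-> ->]. specialize (Q t). split.
    - transitivity ((exp t * exp (- t)) * vp A + vp B * (exp (- t) * exp (- t)));
        [rewrite Q|]; ring.
    - transitivity ((exp t * exp (- t)) * vq A + vq B * (exp (- t) * exp (- t)));
        [rewrite Q|]; ring. }
  apply filterlim_C; [typeclasses eauto|]. simpl. split.
  - apply (is_lim_ext (fun t => (vq A + vq B * (exp (- t) * exp (- t))) / (vp A + vp B * (exp (- t) * exp (- t))))
      _ p_infty (vq A / vp A)).
    + intros t. destruct (K t) as [-> ->]. pose proof (exp_pos (- t)). pose proof (proj1 Hg t).
      field. lra.
    + apply is_lim_div_finite; auto. lra.
  - apply (is_lim_ext (fun t => exp (- t) / (vp A + vp B * (exp (- t) * exp (- t)))) _ p_infty 0).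
    + intros t. destruct (K t) as [-> _]. pose proof (exp_pos (- t)). pose proof (proj1 Hg t).
      field. lra.
    + replace (Finite 0) with (Finite (0 / vp A)) by (f_equal; field; lra).
      apply is_lim_div_finite; auto. lra.
Qed.

Lemma backward_reverse g x : backward_endpoint g x <-> forward_endpoint (fun t => g (- t)) x.
Proof.
  unfold backward_endpoint, forward_endpoint. split; intros H.
  - apply (filterlim_comp _ _ _ Ropp g _ (Rbar_locally m_infty)); [|exact H].
    apply (filterlim_Rbar_opp p_infty).
  - apply (filterlim_ext (fun t => g (- - t))); [intros t; rewrite Ropp_involutive; reflexivity|].
    apply (filterlim_comp _ _ _ Ropp (fun t => g (- t)) _ (Rbar_locally p_infty)); [|exact H].
    apply (filterlim_Rbar_opp m_infty).
Qed.

Lemma geodesic_reverse g : geodesic g -> geodesic (fun t => g (- t)).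
Proof.
  intros [Hp Hd]. split; [intros t; apply Hp|]. intros s t. rewrite Hd.
  replace (- s - - t) with (- (s - t)) by ring. apply Rabs_Ropp.
Qed.

Lemma on_line_backward g A B : geodesic g -> on_line g A B -> 0 < vp B ->
  backward_endpoint g (vq B / vp B).
Proof.
  intros Hg H HB. apply backward_reverse.
  apply (on_line_forward (fun t => g (- t)) B A).
  - apply geodesic_reverse, Hg.
  - apply on_line_reverse, H.
  - exact HB.
Qed.

Lemma forward_unique g x y : forward_endpoint g x -> forward_endpoint g y -> x = y.
Proof.
  intros Hx Hy. apply filterlim_C in Hx, Hy; [|typeclasses eauto..].
  destruct Hx as [Hx _], Hy as [Hy _]. simpl in Hx, Hy.
  apply (filterlim_locally_unique _ _ _ Hx Hy).
Qed.

(** If [vp A] were zero, [Im (g t)] would be the inverse of [vp B * exp (-t)] and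
    would not tend to zero: the forward endpoint would be infinity. *)
Lemma forward_vp_pos g A B x : geodesic g -> on_line g A B -> forward_endpoint g x ->
  0 < vp A /\ x = vq A / vp A.
Proof.
  intros Hg H Hx. pose proof (on_line_nonneg g A B Hg H) as N.
  destruct (Req_dec (vp A) 0) as [E|E].
  - exfalso. apply filterlim_C in Hx; [|typeclasses eauto]. destruct Hx as [_ Hx]. simpl in Hx.
    pose proof (on_line_nonneg _ _ _ (geodesic_reverse g Hg) (on_line_reverse g A B H)) as NB.
    assert (He : 0 < / (vp B + 1)) by (apply Rinv_0_lt_compat; lra).
    rewrite filterlim_locally in Hx. specialize (Hx (mkposreal _ He)).
    destruct Hx as [T HT]. specialize (HT (Rmax T 0 + 1)).
    set (t := Rmax T 0 + 1) in *.
    assert (Ht : T < t /\ 0 < t).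
    { unfold t. pose proof (Rmax_l T 0). pose proof (Rmax_r T 0). lra. }
    specialize (HT (proj1 Ht)). change (Rabs (Im (g t) - 0) < / (vp B + 1)) in HT.
    pose proof (proj1 Hg t) as Pt. rewrite Rminus_0_r, Rabs_pos_eq in HT by lra.
    destruct H as (_ & _ & _ & H). pose proof (f_equal vp (H t)) as Ep. simpl in Ep.
    rewrite E in Ep.
    apply Rinv_lt_contravar in HT; [|nra]. rewrite Rinv_inv, Ep in HT.
    assert (exp (- t) < 1) by (rewrite <- exp_0; apply exp_increasing; lra).
    pose proof (exp_pos (- t)). nra.
  - assert (0 < vp A) by lra. split; [assumption|].
    apply (forward_unique g); [exact Hx|]. apply (on_line_forward g A B); assumption.
Qed.

Lemma backward_vp_pos g A B x : geodesic g -> on_line g A B -> backward_endpoint g x ->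
  0 < vp B /\ x = vq B / vp B.
Proof.
  intros Hg H Hx. apply backward_reverse in Hx.
  apply (forward_vp_pos _ B A x (geodesic_reverse g Hg) (on_line_reverse g A B H) Hx).
Qed.

(** * Closed geodesics *)

Lemma moebius_mul M N z : 0 < Im z -> moebius M (moebius N z) = moebius (sl2_mul M N) z.
Proof.
  intros Hz. destruct (moebius_coords N z Hz) as [P1 E1].
  destruct (moebius_coords M _ P1) as [P2 E2].
  destruct (moebius_coords (sl2_mul M N) z Hz) as [P3 E3].
  apply coords_inj; [assumption..|]. rewrite E2, E1, E3.
  unfold rho. cbn [sl2_mul ma mb mc md vp vq vr]. rewrite !plus_IZR, !mult_IZR.
  f_equal; ring.
Qed.

Lemma moebius_inv M z : 0 < Im z -> moebius (sl2_inv M) (moebius M z) = z.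
Proof.
  intros Hz. rewrite moebius_mul by exact Hz.
  destruct (moebius_coords (sl2_mul (sl2_inv M) M) z Hz) as [P E].
  apply coords_inj; [assumption..|]. rewrite E.
  pose proof (mdet_R M) as D.
  unfold rho. cbn [sl2_mul sl2_inv ma mb mc md]. rewrite !plus_IZR, !mult_IZR, !opp_IZR.
  set (a := IZR (ma M)) in *. set (b := IZR (mb M)) in *.
  set (c := IZR (mc M)) in *. set (d := IZR (md M)) in *.
  replace (d * a + - b * c) with 1 by lra. replace (- c * b + a * d) with 1 by lra.
  replace (d * b + - b * d) with 0 by ring. replace (- c * a + a * c) with 0 by ring.
  apply vec_eq; cbn [vp vq vr]; ring.
Qed.

(** Orbits are sets of points, so this is extensional equality of predicates. *)
Lemma orbit_moebius M z : Theta M -> 0 < Im z -> orbit (moebius M z) = orbit z.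
Proof.
  intros HM Hz. apply functional_extensionality. intros w. apply propositional_extensionality.
  split; intros (N & HN & ->).
  - exists (sl2_mul N M). split; [apply Theta_mul; assumption | apply moebius_mul, Hz].
  - exists (sl2_mul N (sl2_inv M)). split; [apply Theta_mul, Theta_inv; assumption|].
    rewrite <- moebius_mul by (apply moebius_coords, Hz). rewrite moebius_inv by exact Hz.
    reflexivity.
Qed.

Lemma orbit_refl z : 0 < Im z -> orbit z z.
Proof.
  intros Hz. exists sl2_one. split; [apply Theta_one|].
  destruct (moebius_coords sl2_one z Hz) as [P E].
  apply coords_inj; [assumption..|]. rewrite E.
  apply vec_eq; unfold rho; cbn [sl2_one ma mb mc md vp vq vr]; ring.
Qed.

Lemma reals_not_enumerated (u : nat -> R) : exists x, forall n, x <> u n.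
Proof.
  (* nested intervals [[a n, a n + w n]]: step n keeps a third that avoids [u n] *)
  set (w := fun n => (/ 3) ^ n).
  set (a := fix a n := match n with
    | O => 0
    | S m => if Rlt_dec (u m) (a m + w m / 2) then a m + 2 / 3 * w m else a m end).
  assert (Hw : forall n, 0 < w n) by (intros n; apply pow_lt; lra).
  assert (HS : forall n, w (S n) = w n / 3) by (intros n; unfold w; simpl; field).
  assert (Step : forall n, a n <= a (S n) /\ a (S n) + w (S n) <= a n + w n).
  { intros n. specialize (Hw n). rewrite HS. cbn [a].
    destruct Rlt_dec; fold a; lra. }
  assert (Nest : forall n k, a n <= a (n + k)%nat /\ a (n + k)%nat + w (n + k)%nat <= a n + w n).
  { intros n k. induction k; [rewrite Nat.add_0_r; lra|].
    rewrite Nat.add_succ_r. specialize (Step (n + k)%nat). lra. }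
  assert (Upper : forall n m, a m <= a n + w n).
  { intros n m. destruct (Nat.le_ge_cases m n) as [K|K].
    - pose proof (Nest m (n - m)%nat) as [E _]. replace (m + (n - m))%nat with n in E by lia.
      specialize (Hw n). lra.
    - pose proof (Nest n (m - n)%nat) as [_ E]. replace (n + (m - n))%nat with m in E by lia.
      specialize (Hw m). lra. }
  destruct (completeness (fun x => exists m, x = a m)) as [L [Lub Least]].
  - exists (a 0%nat + w 0%nat). intros x [m ->]. apply Upper.
  - exists (a 0%nat), 0%nat. reflexivity.
  - exists L. intros n E.
    assert (L1 : a (S n) <= L) by (apply Lub; exists (S n); reflexivity).
    assert (L2 : L <= a (S n) + w (S n)) by (apply Least; intros x [m ->]; apply Upper).
    rewrite HS in L2. specialize (Hw n). cbn [a] in L1, L2. fold a in L1, L2.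
    destruct Rlt_dec in L1, L2; lra.
Qed.

(** Uncountability of the reals as a pigeonhole principle. *)
Lemma nat_coloring_repeats (f : R -> nat) : exists s t, s <> t /\ f s = f t.
Proof.
  destruct (excluded_middle_informative (exists s t, s <> t /\ f s = f t)) as [E|N];
    [exact E|exfalso].
  destruct (reals_not_enumerated (fun n => epsilon (inhabits 0) (fun t => f t = n))) as [x Hx].
  apply (Hx (f x)).
  destruct (Req_dec x (epsilon (inhabits 0) (fun t => f t = f x))) as [E|E]; [exact E|].
  exfalso. apply N. exists x, (epsilon (inhabits 0) (fun t => f t = f x)). split; [exact E|].
  symmetry. apply (epsilon_spec (inhabits 0) (fun t => f t = f x)). exists x. reflexivity.
Qed.

Definition Z_code (z : Z) : nat :=
  if Z_le_gt_dec 0 z then Z.to_nat (2 * z) else Z.to_nat (- 2 * z - 1).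

Lemma Z_code_inj x y : Z_code x = Z_code y -> x = y.
Proof. unfold Z_code. do 2 destruct Z_le_gt_dec; lia. Qed.

Definition sl2_code (M : SL2Z) : nat :=
  to_nat (to_nat (Z_code (ma M), Z_code (mb M)), to_nat (Z_code (mc M), Z_code (md M))).

Lemma sl2_code_inj M N : sl2_code M = sl2_code N ->
  ma M = ma N /\ mb M = mb N /\ mc M = mc N /\ md M = md N.
Proof.
  unfold sl2_code. intros E. apply to_nat_inj, pair_equal_spec in E. destruct E as [E1 E2].
  apply to_nat_inj, pair_equal_spec in E1, E2. destruct E1 as [Ea Eb], E2 as [Ec Ed].
  auto using Z_code_inj.
Qed.

Lemma moebius_ext M N z : ma M = ma N /\ mb M = mb N /\ mc M = mc N /\ md M = md N ->
  moebius M z = moebius N z.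
Proof. intros (E1 & E2 & E3 & E4). unfold moebius. rewrite E1, E2, E3, E4. reflexivity. Qed.

Lemma exp_opp_independent u v s t : s <> t ->
  u * exp s + v * exp (- s) = 0 -> u * exp t + v * exp (- t) = 0 -> u = 0 /\ v = 0.
Proof.
  intros N Hs Ht.
  assert (Qs : exp s * exp (- s) = 1) by (rewrite <- exp_plus, Rplus_opp_r; apply exp_0).
  assert (Qt : exp t * exp (- t) = 1) by (rewrite <- exp_plus, Rplus_opp_r; apply exp_0).
  pose proof (exp_pos s). pose proof (exp_pos t).
  assert (E : u * ((exp s - exp t) * (exp s + exp t)) = 0).
  { transitivity (exp s * (u * exp s + v * exp (- s)) - exp t * (u * exp t + v * exp (- t))
      - v * (exp s * exp (- s)) + v * (exp t * exp (- t))); [ring|].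
    rewrite Hs, Ht, Qs, Qt. ring. }
  apply Rmult_integral in E. destruct E as [E|E].
  - split; [exact E|]. rewrite E in Hs. pose proof (exp_pos (- s)). nra.
  - exfalso. apply N. apply Rmult_integral in E. destruct E; [apply exp_inv; lra | lra].
Qed.

Definition scale (k : R) (v : vec) : vec := mkvec (k * vp v) (k * vq v) (k * vr v).

(** The element of Theta that carries [g t] to [g (t + T)] may depend on [t].
    Some element [M] serves for two different times, and as [exp t] and
    [exp (-t)] are independent over two times, comparison of coefficients gives
    the action of [M] on [A] and [B]. *)
Lemma closed_translation gbar g A B : is_lift g gbar -> on_line g A B ->
  closed_geodesic_on_Me gbar ->
  exists M T, 0 < T /\ rho M A = scale (exp T) A /\ rho M B = scale (exp (- T)) B.
Proof.
  intros [Hg Hl] (_ & _ & _ & H) (T & HT & Hc).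
  assert (Ex : forall t, exists M, g (t + T) = moebius M (g t)).
  { intros t. specialize (Hc t). rewrite !Hl in Hc.
    pose proof (orbit_refl (g (t + T)) (proj1 Hg _)) as O. rewrite Hc in O.
    destruct O as (M & _ & E). exists M. exact E. }
  set (m := fun t => proj1_sig (constructive_indefinite_description _ (Ex t))).
  assert (Hm : forall t, g (t + T) = moebius (m t) (g t))
    by (intros t; exact (proj2_sig (constructive_indefinite_description _ (Ex t)))).
  destruct (nat_coloring_repeats (fun t => sl2_code (m t))) as (s & t & N & E).
  apply sl2_code_inj in E.
  assert (K : forall r, moebius (m s) (g r) = g (r + T) ->
    lin (exp r) (rho (m s) A) (exp (- r)) (rho (m s) B) =
    lin (exp r) (scale (exp T) A) (exp (- r)) (scale (exp (- T)) B)).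
  { intros r Er. rewrite <- rho_lin, <- H.
    rewrite <- (proj2 (moebius_coords (m s) (g r) (proj1 Hg r))), Er, H.
    unfold lin, scale. cbn [vp vq vr]. rewrite Ropp_plus_distr, !exp_plus. f_equal; ring. }
  pose proof (K s (eq_sym (Hm s))) as Ks.
  assert (Kt : moebius (m s) (g t) = g (t + T)).
  { rewrite Hm. apply moebius_ext, E. }
  apply K in Kt. clear K.
  exists (m s), T. split; [exact HT|].
  pose proof (f_equal vp Ks) as P1. pose proof (f_equal vp Kt) as P2.
  pose proof (f_equal vq Ks) as Q1. pose proof (f_equal vq Kt) as Q2.
  pose proof (f_equal vr Ks) as R1. pose proof (f_equal vr Kt) as R2.
  unfold lin in P1, P2, Q1, Q2, R1, R2. cbn [vp vq vr] in P1, P2, Q1, Q2, R1, R2.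
  destruct (exp_opp_independent (vp (rho (m s) A) - vp (scale (exp T) A))
    (vp (rho (m s) B) - vp (scale (exp (- T)) B)) s t N) as [EpA EpB]; [lra..|].
  destruct (exp_opp_independent (vq (rho (m s) A) - vq (scale (exp T) A))
    (vq (rho (m s) B) - vq (scale (exp (- T)) B)) s t N) as [EqA EqB]; [lra..|].
  destruct (exp_opp_independent (vr (rho (m s) A) - vr (scale (exp T) A))
    (vr (rho (m s) B) - vr (scale (exp (- T)) B)) s t N) as [ErA ErB]; [lra..|].
  split; apply vec_eq; lra.
Qed.

(** For nonzero [A], the alternative [vp A = 0] would mean that [M] fixes
    infinity, so that [a d = 1] and the eigenvalue is one.  Otherwise the eigenvalue is the square
    of the multiplier [c x + d] at the fixed point. *)
Lemma null_eigenvector M A k : pairing A A = 0 -> 0 < k -> k <> 1 -> rho M A = scale k A ->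
  (vp A = 0 -> A = mkvec 0 0 0) /\
  (vp A <> 0 -> denom M (vq A / vp A) ^ 2 = k /\ act M (vq A / vp A) = vq A / vp A).
Proof.
  intros HA Hk K1 E. pose proof (mdet_R M) as Hdet. split; intros N.
  - unfold pairing in HA. rewrite N in HA.
    assert (Hq : vq A = 0) by (apply Rsqr_0_uniq; unfold Rsqr; lra).
    apply vec_eq; simpl; [exact N | exact Hq|].
    unfold rho, scale in E. injection E as E1 _ E3. rewrite N, Hq in E1, E3.
    destruct (Req_dec (vr A) 0) as [|Nr]; [assumption|exfalso].
    assert (C : IZR (mc M) = 0).
    { apply Rsqr_0_uniq. unfold Rsqr. apply (Rmult_eq_reg_r (vr A)); [lra|exact Nr]. }
    assert (A2 : IZR (ma M) * IZR (ma M) = k) by (apply (Rmult_eq_reg_r (vr A)); [lra|exact Nr]).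
    rewrite C in Hdet.
    assert (AD : (ma M * md M = 1)%Z) by (apply eq_IZR; rewrite mult_IZR; lra).
    assert (ma M = 1 \/ ma M = -1)%Z as [Ea|Ea] by (apply Z.mul_eq_1 in AD; lia);
      rewrite Ea in A2; lra.
  - rewrite (null_eq A HA N) in E. set (x := vq A / vp A) in *.
    pose proof (f_equal vp E) as E1. pose proof (f_equal vq E) as E2.
    unfold rho, scale in E1, E2. cbn [vp vq vr] in E1, E2. clear E.
    assert (D2 : denom M x ^ 2 = k).
    { apply (Rmult_eq_reg_l (vp A)); [|exact N].
      etransitivity; [|etransitivity; [exact E1|]]; [unfold denom|]; ring. }
    split; [exact D2|].
    assert (ND : denom M x <> 0) by (intros Z; rewrite Z in D2; lra).
    assert (E3 : (IZR (ma M) * x + IZR (mb M)) * denom M x = k * x).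
    { apply (Rmult_eq_reg_l (vp A)); [|exact N].
      etransitivity; [|etransitivity; [exact E2|]]; [unfold denom|]; ring. }
    unfold act. fold (denom M x).
    apply (Rmult_eq_reg_r (denom M x ^ 2)); [|apply pow_nonzero, ND].
    transitivity ((IZR (ma M) * x + IZR (mb M)) * denom M x); [field; exact ND|].
    rewrite E3, D2. ring.
Qed.

(** A rational root [P/Q] of [z^2 - t z + 1] is an integral unit: in lowest terms
    numerator and denominator divide each other. *)
Lemma rational_unit_eigenvalue (P Q t : Z) : Q <> 0%Z -> (P * P + Q * Q = t * P * Q)%Z ->
  (P = Q \/ P = - Q)%Z.
Proof.
  intros HQ E.
  set (g := Z.gcd P Q).
  assert (Hg : g <> 0%Z) by (intros Z; apply Z.gcd_eq_0 in Z; tauto).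
  destruct (Z.gcd_divide_l P Q) as [p Hp]. destruct (Z.gcd_divide_r P Q) as [q Hq].
  fold g in Hp, Hq.
  assert (G : Z.gcd p q = 1%Z).
  { assert (K : (Z.abs g * Z.gcd p q = Z.abs g * 1)%Z).
    { rewrite <- Z.gcd_mul_mono_l. rewrite (Z.mul_comm g p), (Z.mul_comm g q), <- Hp, <- Hq.
      fold g. assert (0 <= g)%Z by apply Z.gcd_nonneg. lia. }
    apply Z.mul_reg_l in K; [exact K | lia]. }
  assert (Eq : (p * p + q * q = t * p * q)%Z).
  { apply (Z.mul_reg_l _ _ (g * g)); [lia|].
    transitivity (P * P + Q * Q)%Z; [rewrite Hp, Hq; ring|]. rewrite E, Hp, Hq. ring. }
  assert (Dq : (q | p)%Z).
  { apply (Z.gauss q p p); [|rewrite Z.gcd_comm; exact G].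
    exists (t * p - q)%Z. lia. }
  assert (Dp : (p | q)%Z).
  { apply (Z.gauss p q q); [|exact G]. exists (t * q - p)%Z. lia. }
  destruct (Z.divide_antisym p q Dp Dq) as [K|K]; rewrite Hp, Hq, K; [left | right]; ring.
Qed.

(** The multiplier [c x + d] is an eigenvalue of [M], hence a root of
    [z^2 - tr(M) z + 1]; if [x] were rational it would be [1] or [-1]. *)
Lemma fixed_point_irrational M x : act M x = x ->
  denom M x <> 0 -> denom M x ^ 2 <> 1 -> irrational x.
Proof.
  intros Ex ND K (p & q & Hq & Hx).
  apply eq_IZR_contrapositive in Hq as Hq'.
  set (L := denom M x) in *.
  assert (EL : L * IZR q = IZR (mc M * p + md M * q)).
  { rewrite plus_IZR, !mult_IZR. unfold L, denom. rewrite Hx. field. exact Hq'. }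
  (* the multiplier L is an eigenvalue of M *)
  assert (Quad : L * L + 1 = IZR (ma M + md M) * L).
  { assert (F : IZR (ma M) * x + IZR (mb M) = x * L).
    { rewrite <- Ex at 2. unfold act. fold (denom M x). fold L. field. exact ND. }
    pose proof (mdet_R M) as Hdet. rewrite plus_IZR. rewrite <- Hdet.
    assert (G : IZR (mc M) * (IZR (ma M) * x + IZR (mb M)) = IZR (mc M) * (x * L)) by (rewrite F; reflexivity).
    assert (GL : L = IZR (mc M) * x + IZR (md M)) by reflexivity.
    replace (IZR (mc M) * (x * L)) with ((L - IZR (md M)) * L) in G by (rewrite GL at 1; ring).
    replace (IZR (mc M) * (IZR (ma M) * x + IZR (mb M))) with
      (IZR (ma M) * (L - IZR (md M)) + IZR (mb M) * IZR (mc M)) in G by (rewrite GL; ring).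
    lra. }
  set (P := (mc M * p + md M * q)%Z) in *.
  assert (EZ : (P * P + q * q = (ma M + md M) * P * q)%Z).
  { apply eq_IZR. rewrite plus_IZR, !mult_IZR, <- EL.
    transitivity ((L * L + 1) * (IZR q * IZR q)); [ring|]. rewrite Quad. ring. }
  apply K.
  destruct (rational_unit_eigenvalue P q _ Hq EZ) as [E|E]; rewrite E in EL.
  - assert (L = 1) as -> by (apply (Rmult_eq_reg_r (IZR q)); lra). ring.
  - rewrite opp_IZR in EL.
    assert (L = -1) as -> by (apply (Rmult_eq_reg_r (IZR q)); lra). ring.
Qed.

Lemma hyperbolic_fixed_conjugate M x y : act M x = x -> act M y = y ->
  denom M x <> 0 -> denom M x ^ 2 <> 1 -> denom M y <> 0 -> y <> x ->
  irrational x /\ is_conjugate x y.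
Proof.
  intros Ex Ey Dx Kx Dy N.
  pose proof (fixed_point_irrational M x Ex Dx Kx) as Ix. split; [exact Ix|].
  apply (fixed_points_conjugate M); auto.
  intros Hb. apply Kx.
  assert (F : IZR (ma M) * x + IZR (mb M) = x * denom M x).
  { rewrite <- Ex at 2. unfold act. fold (denom M x). field. exact Dx. }
  rewrite Hb in F. unfold denom in F.
  assert (Lx : IZR (mc M) * x + IZR (md M - ma M) = 0).
  { rewrite minus_IZR. apply (Rmult_eq_reg_l x); [lra|]. apply (irrational_not_IZR x 0 Ix). }
  apply irrational_lin in Lx; [|exact Ix]. destruct Lx as [C A].
  assert (AD : (md M * md M = 1)%Z).
  { pose proof (mdet M) as D. rewrite Hb, C in D. replace (ma M) with (md M) in D by lia. lia. }
  unfold denom. rewrite C. apply (f_equal IZR) in AD. rewrite mult_IZR in AD. lra.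
Qed.

(** A first step [z |-> s / (z - a)] brings [x] beyond [1]; its expansion then
    makes the conjugate reduced after finitely many digits, and from there on
    it is purely periodic.  The signed versions of all these steps lie in
    Theta, and the accumulated sign is [e]. *)
Lemma conjugate_pair_reduces x y : irrational x -> is_conjugate x y ->
  exists N l e, Theta N /\ is_block l /\ (e = 1 \/ e = -1)%Z /\ sign_prod l = 1%Z /\
    1 < ecf_int (cycle l) /\ -1 < ext_ecf (cycle (rev l)) < 1 /\
    act N x = IZR e * ecf_int (cycle l) /\
    act N y = - IZR e * ext_ecf (cycle (rev l)).
Proof.
  intros Hx C. pose proof (is_conjugate_irrational _ _ Hx C) as Hy.
  set (a := near_even x). set (s := if Rle_dec 0 (x - IZR a) then 1%Z else (-1)%Z).
  assert (Hs : s = 1%Z \/ s = (-1)%Z) by (unfold s; destruct Rle_dec; auto).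
  assert (Ha : Z.Even a) by apply Even_near_even.
  pose proof (near_even_bound x Hx) as Ba. fold a in Ba.
  set (al := IZR s / (x - IZR a)). set (be := IZR s / (y - IZR a)).
  assert (Nx : x - IZR a <> 0) by (pose proof (irrational_not_IZR x a Hx); lra).
  assert (Ny : y - IZR a <> 0) by (pose proof (irrational_not_IZR y a Hy); lra).
  assert (Ial : irrational al) by (apply irrational_step; [destruct Hs; lia | exact Hx]).
  assert (Ibe : irrational be) by (apply irrational_step; [destruct Hs; lia | exact Hy]).
  assert (Gal : 1 < al).
  { unfold al, s. destruct Rle_dec.
    - apply Rlt_div_r; lra.
    - replace (-1 / (x - IZR a)) with (1 / (IZR a - x)) by (field; lra). apply Rlt_div_r; lra. }
  assert (Cal : is_conjugate al be).
  { destruct C as (A & B & C & HA & Rx & Ry & N).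
    apply (surd_pair_conjugate (B * B - 4 * A * C) (form_step (a, s) (A, B, C))).
    apply (surd_pair_step _ _ (a, s) x y Hs Hx). repeat split; assumption. }
  destruct (ecf_int_exists al Ial Gal) as (d & Hd & Ed).
  assert (Id : irrational (ecf_int d)) by (rewrite <- Ed; exact Ial).
  assert (Cd : is_conjugate (ecf_int d) be) by (rewrite <- Ed; exact Cal).
  destruct (surd_eventually_reduced d be Hd Id Cd) as (n & Hn & Cn).
  pose proof (ecf_int_irrational_skip d n Hd Id) as In.
  pose proof (skip_admissible n d Hd) as Hdn.
  destruct (reduced_purely_periodic (skip n d) _ Hdn In Cn Hn) as (p & Hp & Per).
  pose proof (prefix_block (skip n d) p Hp Hdn) as Hb.
  destruct (positive_block _ Hb) as (l & Hl & Sl & El & Er).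
  rewrite <- (periodic_cycle _ p Hp Per) in El.
  pose proof (ecf_int_gt_1 _ Hdn In) as Gn.
  assert (Gl : 1 < ecf_int (cycle l)) by (rewrite El; exact Gn).
  destruct (periodic_conjugate l Hl Gl) as [Cl Bl].
  rewrite El in Cl. pose proof (is_conjugate_unique _ _ _ In Cn Cl) as Eb.
  assert (Hs' : (- s = 1 \/ - s = -1)%Z) by (destruct Hs as [-> | ->]; auto).
  destruct (orbit_matrix_irrational d n (- s) Hd Hs') as (M & HM & _ & A).
  set (N := sl2_branch a sl2_one).
  assert (HN : Theta N) by (apply Theta_branch; [exact Ha | apply Theta_one]).
  assert (AN : forall z, irrational z -> act N z = IZR (- s) * (IZR s / (z - IZR a))).
  { intros z Hz. pose proof (irrational_not_IZR z a Hz).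
    assert (E1 : act sl2_one z = z) by (unfold act; simpl; field).
    assert (D1 : denom sl2_one z <> 0) by (unfold denom; simpl; lra).
    unfold N. rewrite (proj2 (act_branch a sl2_one z D1 ltac:(rewrite E1; assumption))), E1.
    rewrite opp_IZR. destruct (sign_cases s Hs) as [-> | ->]; field; lra. }
  assert (AMN : forall z, irrational z -> act (sl2_mul M N) z =
      IZR (- s) * IZR (sign_prod (prefix n d)) * digit_orbit d (IZR s / (z - IZR a)) n).
  { intros z Hz. destruct (act_irrational N z Hz) as [D1 I1].
    destruct (act_irrational M _ I1) as [D2 _].
    rewrite act_mul, AN, A by (assumption || (apply irrational_step; [destruct Hs; lia | exact Hz])).
    reflexivity. }
  exists (sl2_mul M N), l, (- s * sign_prod (prefix n d))%Z.
  split; [apply Theta_mul; assumption|]. split; [exact Hl|]. split.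
  { destruct Hs as [-> | ->], (sign_prod_unit _ (prefix_admissible n d Hd)) as [-> | ->]; auto. }
  split; [exact Sl|]. split; [exact Gl|]. split; [lra|]. split.
  - rewrite AMN by exact Hx. fold al. rewrite Ed, digit_orbit_ecf, El, mult_IZR by exact Hd.
    reflexivity.
  - rewrite AMN by exact Hy. fold be. rewrite Eb, mult_IZR. ring.
Qed.

Lemma null_rho M A : pairing A A = 0 -> vp A <> 0 -> denom M (vq A / vp A) <> 0 ->
  vp (rho M A) = vp A * denom M (vq A / vp A) ^ 2 /\
  vq (rho M A) / vp (rho M A) = act M (vq A / vp A).
Proof.
  intros HA N D.
  pose proof (null_eq A HA N) as EA. set (x := vq A / vp A) in *.
  assert (E1 : vp (rho M A) = vp A * denom M x ^ 2).
  { transitivity (vp (rho M (mkvec (vp A) (vp A * x) (vp A * (x * x)))));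
      [f_equal; f_equal; exact EA|]. unfold rho, denom. cbn [vp vq vr]. ring. }
  assert (E2 : vq (rho M A) = vp A * denom M x * (IZR (ma M) * x + IZR (mb M))).
  { transitivity (vq (rho M (mkvec (vp A) (vp A * x) (vp A * (x * x)))));
      [f_equal; f_equal; exact EA|]. unfold rho, denom. cbn [vp vq vr]. ring. }
  split; [exact E1|]. rewrite E1, E2. unfold act. fold (denom M x). field. auto.
Qed.

Lemma moebius_endpoints M g A B : geodesic g -> on_line g A B -> 0 < vp A -> 0 < vp B ->
  denom M (vq A / vp A) <> 0 -> denom M (vq B / vp B) <> 0 ->
  forward_endpoint (fun t => moebius M (g t)) (act M (vq A / vp A)) /\
  backward_endpoint (fun t => moebius M (g t)) (act M (vq B / vp B)).
Proof.
  intros Hg H PA PB DA DB.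
  pose proof (geodesic_moebius M g Hg) as Hg'.
  pose proof (on_line_moebius M g A B Hg H) as H'.
  destruct H as (NA & NB & _).
  destruct (null_rho M A NA ltac:(lra) DA) as [VA EA].
  destruct (null_rho M B NB ltac:(lra) DB) as [VB EB].
  rewrite <- EA, <- EB. split.
  - apply (on_line_forward _ _ (rho M B)); [exact Hg' | exact H'|].
    rewrite VA. apply Rmult_lt_0_compat; [exact PA | apply pow2_gt_0, DA].
  - apply (on_line_backward _ (rho M A)); [exact Hg' | exact H'|].
    rewrite VB. apply Rmult_lt_0_compat; [exact PB | apply pow2_gt_0, DB].
Qed.

Lemma pairing_null A B : pairing A A = 0 -> pairing B B = 0 -> vp A <> 0 -> vp B <> 0 ->
  pairing A B = vp A * vp B * (vq A / vp A - vq B / vp B) ^ 2.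
Proof.
  intros HA HB NA NB.
  rewrite (null_eq A HA NA) at 1. rewrite (null_eq B HB NB) at 1.
  unfold pairing. cbn [vp vq vr]. ring.
Qed.

Lemma closed_has_periodic_lift gbar : geodesic_on_Me gbar -> closed_geodesic_on_Me gbar ->
  exists (g : R -> C) (l : list digit) (e : Z),
    is_lift g gbar /\ A_e g /\ is_block l /\ (e = 1%Z \/ e = (-1)%Z) /\
    forward_endpoint g (IZR e * ecf_int (cycle l)) /\
    backward_endpoint g (- IZR e * ext_ecf (cycle (rev l))) /\
    sign_prod l = 1%Z.
Proof.
  intros [g Hlift] Hc. pose proof (proj1 Hlift) as Hg.
  destruct (geodesic_line g Hg) as (A & B & HL).
  destruct (closed_translation gbar g A B Hlift HL Hc) as (M & T & HT & EA & EB).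
  pose proof (on_line_nonneg g A B Hg HL) as PA.
  pose proof (on_line_nonneg _ _ _ (geodesic_reverse g Hg) (on_line_reverse g A B HL)) as PB.
  destruct HL as (NA & NB & NAB & HL').
  assert (HL : on_line g A B) by (repeat split; assumption). clear HL'.
  assert (K1 : exp T <> 1) by (rewrite <- exp_0; intros E; apply exp_inv in E; lra).
  assert (K2 : exp (- T) <> 1) by (rewrite <- exp_0; intros E; apply exp_inv in E; lra).
  destruct (null_eigenvector M A _ NA (exp_pos T) K1 EA) as [ZA FA].
  destruct (null_eigenvector M B _ NB (exp_pos (- T)) K2 EB) as [ZB FB].
  assert (QA : vp A <> 0).
  { intros E. rewrite (ZA E) in NAB. unfold pairing in NAB. simpl in NAB. lra. }
  assert (QB : vp B <> 0).
  { intros E. rewrite (ZB E) in NAB. unfold pairing in NAB. simpl in NAB. lra. }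
  destruct (FA QA) as [DA AA]. destruct (FB QB) as [DB AB]. clear ZA ZB FA FB.
  pose proof (pairing_null A B NA NB QA QB) as FN. rewrite NAB in FN.
  set (x := vq A / vp A) in *. set (y := vq B / vp B) in *.
  assert (Nxy : y <> x) by (intros E; rewrite E in FN; lra).
  pose proof (exp_pos T) as ET. pose proof (exp_pos (- T)) as ET'.
  assert (Dx : denom M x <> 0) by (intros E; rewrite E in DA; lra).
  assert (Dy : denom M y <> 0) by (intros E; rewrite E in DB; lra).
  assert (Kx : denom M x ^ 2 <> 1) by (rewrite DA; exact K1).
  destruct (hyperbolic_fixed_conjugate M x y AA AB Dx Kx Dy Nxy) as [Ix Cxy].
  pose proof (is_conjugate_irrational _ _ Ix Cxy) as Iy.
  destruct (conjugate_pair_reduces x y Ix Cxy) as (N & l & e & HN & Hl & He & Sl & Gl & Bl & Ex & Ey).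
  destruct (moebius_endpoints N g A B Hg HL) as [Ff Fb]; try lra.
  { apply (act_irrational N x Ix). } { apply (act_irrational N y Iy). }
  fold x in Ff. fold y in Fb. rewrite Ex in Ff. rewrite Ey in Fb.
  pose proof (geodesic_moebius N g Hg) as Hg'.
  exists (fun t => moebius N (g t)), l, e.
  split; [|split; [|repeat split; try assumption; apply Hl]].
  - split; [exact Hg'|]. intros t. rewrite orbit_moebius by (assumption || apply Hg).
    apply Hlift.
  - split; [exact Hg'|]. eexists. eexists. split; [exact Ff|]. split; [exact Fb|].
    unfold S_e. destruct (sign_cases e He) as [-> | ->]; lra.
Qed.

(** In coordinates, multiplying [A] by [k] and dividing [B] by [k] is the time
    shift by [ln k], so [M] moves [g t] to [g (t + ln k)].  If [ln k] is
    negative, the period is [- ln k]. *)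
Lemma translation_closes g gbar A B M k : is_lift g gbar -> on_line g A B -> Theta M ->
  0 < k -> k <> 1 -> rho M A = scale k A -> rho M B = scale (/ k) B ->
  closed_geodesic_on_Me gbar.
Proof.
  intros [Hg Hl] (_ & _ & _ & H) HM Hk K1 EA EB.
  assert (Tr : forall t, g (t + ln k) = moebius M (g t)).
  { intros t. destruct (moebius_coords M (g t) (proj1 Hg t)) as [P E].
    apply coords_inj; [apply Hg | exact P|].
    rewrite E, !H, rho_lin, EA, EB. unfold lin, scale. cbn [vp vq vr].
    rewrite Ropp_plus_distr, !exp_plus, (exp_Ropp (ln k)), exp_ln by exact Hk.
    f_equal; ring. }
  assert (Per : forall t, gbar (t + ln k) = gbar t).
  { intros t. rewrite !Hl, Tr. apply orbit_moebius; [exact HM | apply Hg]. }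
  assert (Nz : ln k <> 0).
  { intros E. apply K1. apply ln_inv; [exact Hk | lra | rewrite E, ln_1; reflexivity]. }
  destruct (Rtotal_order (ln k) 0) as [L|[L|L]]; [|contradiction|].
  - exists (- ln k). split; [lra|]. intros t. rewrite <- (Per (t + - ln k)). f_equal. ring.
  - exists (ln k). split; assumption.
Qed.

(** The matrix [M] of the period fixes both endpoints, so the corresponding null
    vectors are eigenvectors, with eigenvalues the squares of the multipliers.
    The multiplier at [x] is not [1] or [-1] because [c x + d] is irrational. *)
Lemma periodic_lift_closed gbar g l e :
  is_lift g gbar -> A_e g -> is_block l -> (e = 1%Z \/ e = (-1)%Z) ->
  forward_endpoint g (IZR e * ecf_int (cycle l)) ->
  backward_endpoint g (- IZR e * ext_ecf (cycle (rev l))) ->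
  sign_prod l = 1%Z -> closed_geodesic_on_Me gbar.
Proof.
  intros Hlift (Hg & x0 & y0 & Hx0 & _ & HS) Hl He Ff Fb Sl.
  rewrite (forward_unique _ _ _ Hx0 Ff) in HS. clear x0 Hx0.
  assert (Gl : 1 < ecf_int (cycle l)).
  { pose proof (ecf_int_ge_1 _ (cycle_admissible l Hl)).
    unfold S_e in HS. destruct (sign_cases e He) as [E|E]; rewrite E in HS; lra. }
  pose proof (cycle_irrational l Hl Gl) as Ia.
  destruct (geodesic_line g Hg) as (A & B & HL).
  destruct (forward_vp_pos g A B _ Hg HL Ff) as [PA Ex].
  destruct (backward_vp_pos g A B _ Hg HL Fb) as [PB Ey].
  destruct (periodic_matrix l e Hl Gl Sl He) as (M & HM & Hb & F).
  destruct (F _ (or_introl eq_refl)) as [Dx Ax]. destruct (F _ (or_intror eq_refl)) as [Dy Ay].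
  replace (IZR e * - ext_ecf (cycle (rev l))) with (- IZR e * ext_ecf (cycle (rev l))) in Dy, Ay by ring.
  assert (Ix : irrational (IZR e * ecf_int (cycle l))).
  { destruct (irrational_moebius (ecf_int (cycle l)) e 0 0 1 Ia) as [_ I]; [destruct He; lia|].
    replace (IZR e * ecf_int (cycle l)) with ((IZR e * ecf_int (cycle l) + 0) / (0 * ecf_int (cycle l) + 1))
      by field. exact I. }
  rewrite Ex in Ix, Dx, Ax. rewrite Ey in Dy, Ay.
  pose proof HL as (NA & NB & NAB & _).
  pose proof (pairing_null A B NA NB ltac:(lra) ltac:(lra)) as FN. rewrite NAB in FN.
  assert (Nxy : vq B / vp B <> vq A / vp A) by (intros E; rewrite E in FN; lra).
  destruct (fixed_points_conjugate M _ _ Hb Ix Dy Ax Ay Nxy) as [Hc _].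
  assert (Eig : forall V, pairing V V = 0 -> vp V <> 0 -> denom M (vq V / vp V) <> 0 ->
     act M (vq V / vp V) = vq V / vp V -> rho M V = scale (denom M (vq V / vp V) ^ 2) V).
  { intros V HV NV DV AV. set (z := vq V / vp V) in *.
    assert (EV : IZR (ma M) * z + IZR (mb M) = z * denom M z).
    { rewrite <- AV at 2. unfold act. fold (denom M z). field. exact DV. }
    rewrite (null_eq V HV NV). fold z. unfold rho, scale. cbn [vp vq vr].
    f_equal.
    - unfold denom. ring.
    - transitivity (vp V * ((IZR (ma M) * z + IZR (mb M)) * denom M z)); [unfold denom; ring|].
      rewrite EV. ring.
    - transitivity (vp V * ((IZR (ma M) * z + IZR (mb M)) * (IZR (ma M) * z + IZR (mb M)))); [ring|].
      rewrite EV. ring. }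
  pose proof (Eig A NA ltac:(lra) Dx Ax) as EA. pose proof (Eig B NB ltac:(lra) Dy Ay) as EB.
  set (kx := denom M (vq A / vp A)) in *. set (ky := denom M (vq B / vp B)) in *.
  (* M preserves the pairing, so the two multipliers are inverse to each other *)
  assert (Inv : kx ^ 2 * ky ^ 2 = 1).
  { pose proof (pairing_rho M A B) as FR. rewrite EA, EB, NAB in FR.
    rewrite <- FR. rewrite <- (Rmult_1_r (kx ^ 2 * ky ^ 2)), <- NAB.
    unfold pairing, scale. cbn [vp vq vr]. ring. }
  pose proof (pow2_gt_0 kx Dx) as Pk.
  apply (translation_closes g gbar A B M (kx ^ 2)); try assumption.
  - intros E.
    assert (K : (kx - 1) * (kx + 1) = 0) by lra. apply Rmult_integral in K.
    destruct K as [K|K].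
    + apply Hc. apply (irrational_lin _ (mc M) (md M - 1) Ix). rewrite minus_IZR.
      unfold kx, denom in K. lra.
    + apply Hc. apply (irrational_lin _ (mc M) (md M + 1) Ix). rewrite plus_IZR.
      unfold kx, denom in K. lra.
  - rewrite EB. f_equal. apply (Rmult_eq_reg_l (kx ^ 2)); [|lra]. rewrite Inv. field. exact Dx.
Qed.

Theorem proposition10 :
  (* (i) *)
  (forall alpha : R, 1 < alpha ->
    (has_purely_periodic_ecf alpha <->
       quadratic_surd alpha /\ -1 < surd_conj alpha < 1) /\
    (forall l : list digit, is_block l -> alpha = ecf_int (cycle l) ->
       surd_conj alpha = - ext_ecf (cycle (rev l)))) /\
  (* (ii) *)
  (forall alpha beta : R, irrational alpha -> irrational beta ->
    1 < alpha -> 1 < beta ->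
    (Theta_equiv alpha beta <->
       exists r s : nat, ecf_tail r alpha = ecf_tail s beta)) /\
  (* (iii) *)
  (forall alpha : R, irrational alpha -> 0 < alpha ->
    (eventually_periodic (ecf_digits alpha) <-> quadratic_surd alpha)) /\
  (* (iv) *)
  (forall gbar : R -> C -> Prop, geodesic_on_Me gbar ->
    (closed_geodesic_on_Me gbar <->
       exists (g : R -> C) (l : list digit) (e : Z),
         is_lift g gbar /\ A_e g /\ is_block l /\
         (e = 1%Z \/ e = (-1)%Z) /\
         forward_endpoint g (IZR e * ecf_int (cycle l)) /\
         backward_endpoint g (- IZR e * ext_ecf (cycle (rev l))) /\
         sign_prod l = 1%Z)).
Proof.
  split; [|split; [|split]].
  - intros alpha H1. split; [apply purely_periodic_iff, H1|].
    intros l. apply surd_conj_periodic, H1.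
  - intros alpha beta Ia Ib Ha Hb. apply Theta_equiv_iff_tails; assumption.
  - intros alpha Ia Ha. apply eventually_periodic_iff; assumption.
  - intros gbar Hg. split; [apply closed_has_periodic_lift, Hg|].
    intros (g & l & e & H1 & H2 & H3 & H4 & H5 & H6 & H7).
    eapply periodic_lift_closed; eauto.
Qed.
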